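(* Let $0\le k\le\mu$ be integers. (i) For $f\in\mathrm{Im}(R_\mu)$, $((\nu+1)B_\nu)^{-1}(f)$ converges uniformly to $f$ as $\nu\to\infty$. (ii) For $f\in C(\mathbb{CP}^1)$, $((\mu+\nu-2k+1)B_{\mu+\nu-2k})^{-1}E^\nu_{\mu,k}(f)$ converges uniformly on $\mathbb{C}$ to $E_{\mu,k}(f)$ as $\nu\to\infty$.
   Context: For an integer $\tau\ge0$, $\mathcal{H}_\tau$ is the space of polynomials in one complex variable of degree $\le\tau$, with inner product $\langle f,g\rangle=\int_{\mathbb{C}}f\overline g\,d\iota_\tau$, $d\iota_\tau(z)=\frac{\tau+1}{(1+|z|^2)^\tau}\frac{dA(z)}{\pi(1+|z|^2)^2}$ ($dA$ Lebesgue measure); $d\iota:=d\iota_0$. It has reproducing kernel $K^\tau(x,y)=(1+x\overline y)^\tau$; the kernel of $\Gamma\in B(\mathcal{H}_\tau)$ is $\Gamma(x,y):=\Gamma(K^\tau(\cdot,y))(x)$. $C(\mathbb{CP}^1)$: continuous functions on $\mathbb{C}$ extending continuously to $\infty$, sup norm. $R_\tau(\Gamma)(z)=\Gamma(z,z)/(1+|z|^2)^\tau$ and $\mathrm{Im}(R_\mu)=\{R_\mu(\Gamma):\Gamma\in B(\mathcal{H}_\mu)\}$, a finite-dimensional subspace of $C(\mathbb{CP}^1)$. $R_\tau^*(f)$ is the operator $(R_\tau^*(f)h)(x)=\frac1{\tau+1}\int f(z)h(z)(1+x\overline z)^\tau d\iota_\tau(z)$, and $B_\tau(f)(z)=\int_{\mathbb{C}}\frac{|1+z\overline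 s|^{2\tau}}{(1+|z|^2)^\tau(1+|s|^2)^\tau}f(s)\,d\iota(s)$. For $\tau\ge\mu$, $B_\tau$ maps $\mathrm{Im}(R_\mu)$ bijectively onto itself, and $(cB_\tau)^{-1}$ denotes the inverse of $cB_\tau$ restricted to $\mathrm{Im}(R_\mu)$. $\mathcal{H}_\mu\otimes\mathcal{H}_\nu$ is realized as polynomials $F(z,w)$ of degree $\le\mu$ in $z$, $\le\nu$ in $w$, inner product of $L^2(d\iota_\mu(z)d\iota_\nu(w))$; $J_k(F)(\xi)=\int F(z,w)(\overline z-\overline w)^k(1+\xi\overline z)^{\mu-k}(1+\xi\overline w)^{\nu-k}d\iota_\mu(z)d\iota_\nu(w)\in\mathcal{H}_{\mu+\nu-2k}$; $C_{\mu,\nu,k}>0$ with $C_{\mu,\nu,k}^2=\frac{(-\nu)_k(-\mu)_k}{k!(\mu+\nu-2k+2)_k}$ (rising Pochhammer symbols); $P_k=C_{\mu,\nu,k}J_k$; $\mathcal{T}^\nu_{\mu,k}(A)=P_k(A\otimes I)P_k^*$. For $\nu>\mu$, $E^\nu_{\mu,k}(f):=R_{\mu+\nu-2k}(\mathcal{T}^\nu_{\mu,k}(R_\mu^*(f)))$, which lies in $\mathrm{Im}(R_\mu)$, and $E_{\mu,k}(f):=\binom{\mu}{k}\sum_{l=0}^k(-1)^{k-l}\binom kl B_{\mu-l}(f)$. *)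

(* Defs.v *)
From HB Require Import structures.
From mathcomp Require Import all_boot all_order all_algebra.
From mathcomp Require Import all_classical all_reals all_analysis.
From mathcomp Require Import complex.
From Stdlib Require Import ClassicalEpsilon.

Set Implicit Arguments.
Unset Strict Implicit.
Unset Printing Implicit Defensive.

Import Order.TTheory GRing.Theory Num.Theory.
Local Open Scope ring_scope.
Local Open Scope complex_scope.

Section Defs.
Variable R : realType.
Local Notation C := R[i].

(* modulus |z| (real-valued) and |z|^2 *)
Definition nsq (z : C) : R := complex.Re z ^+ 2 + complex.Im z ^+ 2.
Definition normc (z : C) : R := Num.sqrt (nsq z).
Definition wt (z : C) : R := 1 + nsq z.

(* Integral over C w.r.t. Lebesgue measure dA on C = R x R, of a complex-valued
   function (real and imaginary parts integrated separately). *)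
Definition leb2 := ((@lebesgue_measure R) \x (@lebesgue_measure R))%E.
Definition cint (g : C -> C) : C :=
  (Rintegral leb2 setT (fun p : R * R => complex.Re (g (p.1 +i* p.2))))
  +i* (Rintegral leb2 setT (fun p : R * R => complex.Im (g (p.1 +i* p.2)))).

(* d iota_tau (z) = (tau+1)/(1+|z|^2)^tau * dA(z) / (pi (1+|z|^2)^2) *)
Definition iota_dens (tau : nat) (z : C) : R :=
  tau.+1%:R / (wt z ^+ tau) / (pi * wt z ^+ 2).
Definition iint (tau : nat) (g : C -> C) : C :=
  cint (fun z => g z * (iota_dens tau z)%:C).

(* H_tau : polynomial functions of degree <= tau *)
Definition inH (tau : nat) (h : C -> C) : Prop :=
  exists p : {poly C}, (size p <= tau.+1)%N /\ h = (fun x => p.[x]).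

(* Reproducing kernel K^tau(x,y) = (1 + x conj y)^tau *)
Definition Kern (tau : nat) (x y : C) : C := (1 + x * y^*) ^+ tau.

(* Bounded operators on H_tau: linear maps H_tau -> H_tau
   (represented as maps on functions; only their values on H_tau matter). *)
Definition isOp (tau : nat) (G : (C -> C) -> (C -> C)) : Prop :=
  (forall h, inH tau h -> inH tau (G h)) /\
  (forall (a : C) h1 h2, inH tau h1 -> inH tau h2 ->
     G (fun x => a * h1 x + h2 x) = (fun x => a * G h1 x + G h2 x)).

(* kernel of an operator: Gamma(x,y) = Gamma(K^tau(.,y))(x) *)
Definition kernelOf (tau : nat) (G : (C -> C) -> (C -> C)) (x y : C) : C :=
  G (fun s => Kern tau s y) x.

(* R_tau(Gamma)(z) = Gamma(z,z) / (1+|z|^2)^tau *)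
Definition Rop (tau : nat) (G : (C -> C) -> (C -> C)) (z : C) : C :=
  kernelOf tau G z z / (wt z ^+ tau)%:C.

(* Im(R_mu) *)
Definition ImR (mu : nat) (f : C -> C) : Prop :=
  exists G, isOp mu G /\ f = Rop mu G.

(* R_tau^*(f) *)
Definition Rstar (tau : nat) (f : C -> C) (h : C -> C) (x : C) : C :=
  (tau.+1%:R)^-1 * iint tau (fun z => f z * h z * (1 + x * z^*) ^+ tau).

(* Berezin transform B_tau *)
Definition Ber (tau : nat) (f : C -> C) (z : C) : C :=
  iint 0 (fun s => ((((1 + z * s^*) * (1 + z^* * s)) ^+ tau)
                    / (wt z ^+ tau * wt s ^+ tau)%:C) * f s).

(* (c B_tau)^{-1} restricted to Im(R_mu): the g in Im(R_mu) with c B_tau(g) = f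
   (well defined for tau >= mu, where c B_tau is a bijection of Im(R_mu)). *)
Definition BerInv (mu : nat) (c : C) (tau : nat) (f : C -> C) : C -> C :=
  epsilon (inhabits (fun _ : C => 0))
    (fun g => ImR mu g /\ (fun z => c * Ber tau g z) = f).

(* Tensor product H_mu (x) H_nu: polynomial functions F(z,w) of degree
   <= mu in z and <= nu in w. *)
Definition inH2 (mu nu : nat) (F : C -> C -> C) : Prop :=
  exists p : {poly {poly C}}, (size p <= nu.+1)%N /\
    (forall i, (size (nth 0%R (polyseq p) i) <= mu.+1)%N) /\
    F = (fun z w => (p.[w%:P]).[z]).

(* integral w.r.t. d iota_mu(z) d iota_nu(w) (iterated) *)
Definition iint2 (mu nu : nat) (F : C -> C -> C) : C :=
  iint mu (fun z => iint nu (fun w => F z w)).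

Definition ip (tau : nat) (f g : C -> C) : C := iint tau (fun z => f z * (g z)^*).
Definition ip2 (mu nu : nat) (F G : C -> C -> C) : C :=
  iint2 mu nu (fun z w => F z w * (G z w)^*).

(* J_k *)
Definition Jk (mu nu k : nat) (F : C -> C -> C) (xi : C) : C :=
  iint2 mu nu (fun z w => F z w * (z^* - w^*) ^+ k
        * (1 + xi * z^*) ^+ (mu - k) * (1 + xi * w^*) ^+ (nu - k)).

(* rising Pochhammer symbol (a)_k *)
Definition poch (a : R) (k : nat) : R := \prod_(i < k) (a + i%:R).

(* C_{mu,nu,k} > 0 with C^2 = (-nu)_k (-mu)_k / (k! (mu+nu-2k+2)_k) *)
Definition Cmnk (mu nu k : nat) : R :=
  Num.sqrt (poch (- nu%:R) k * poch (- mu%:R) k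
            / (k`!%:R * poch ((mu + nu - 2 * k)%:R + 2) k)).

Definition Pk (mu nu k : nat) (F : C -> C -> C) (xi : C) : C :=
  (Cmnk mu nu k)%:C * Jk mu nu k F xi.

(* adjoint P_k^* : H_{mu+nu-2k} -> H_mu (x) H_nu, defined by
   <P_k F, g> = <F, P_k^* g> (unique linear map with this property) *)
Definition isPkAdj (mu nu k : nat) (Q : (C -> C) -> (C -> C -> C)) : Prop :=
  (forall g, inH (mu + nu - 2 * k) g -> inH2 mu nu (Q g)) /\
  (forall F g, inH2 mu nu F -> inH (mu + nu - 2 * k) g ->
     ip (mu + nu - 2 * k) (Pk mu nu k F) g = ip2 mu nu F (Q g)).

Definition PkAdj (mu nu k : nat) : (C -> C) -> (C -> C -> C) :=
  epsilon (inhabits (fun _ _ _ => 0)) (isPkAdj mu nu k).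

(* A (x) I on H_mu (x) H_nu *)
Definition tensI (A : (C -> C) -> (C -> C)) (F : C -> C -> C) : C -> C -> C :=
  fun z w => A (fun z' => F z' w) z.

(* T^nu_{mu,k}(A) = P_k (A (x) I) P_k^* *)
Definition Top (mu nu k : nat) (A : (C -> C) -> (C -> C)) (g : C -> C) : C -> C :=
  Pk mu nu k (tensI A (PkAdj mu nu k g)).

(* E^nu_{mu,k}(f) = R_{mu+nu-2k}(T^nu_{mu,k}(R_mu^*(f))) *)
Definition Enu (mu nu k : nat) (f : C -> C) : C -> C :=
  Rop (mu + nu - 2 * k) (Top mu nu k (Rstar mu f)).

(* E_{mu,k}(f) = binom(mu,k) sum_{l=0}^k (-1)^(k-l) binom(k,l) B_{mu-l}(f) *)
Definition Emk (mu k : nat) (f : C -> C) (z : C) : C :=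
  'C(mu, k)%:R * \sum_(0 <= l < k.+1) ((-1) ^+ (k - l) * 'C(k, l)%:R * Ber (mu - l) f z).

(* C(CP^1): continuous on C and extends continuously to infinity *)
Definition CP1cont (f : C -> C) : Prop :=
  (forall z (e : R), 0 < e -> exists2 d : R, 0 < d &
      forall w, normc (w - z) < d -> normc (f w - f z) < e) /\
  (exists L : C, forall e : R, 0 < e -> exists M : R,
      forall w, M < normc w -> normc (f w - L) < e).

(* uniform convergence on C of a sequence of functions *)
Definition unif_cvg (g : nat -> C -> C) (f : C -> C) : Prop :=
  forall e : R, 0 < e -> exists N : nat, forall n, (N <= n)%N ->
    forall z, normc (g n z - f z) < e.

End Defs.

(* Main.v *)
Require Import Defs.
From mathcomp Require Import all_boot all_order all_algebra.
From mathcomp Require Import all_classical all_reals all_analysis.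
From mathcomp Require Import measurable_realfun complex zify ring lra.
From Stdlib Require ClassicalEpsilon.

Set Implicit Arguments.
Unset Strict Implicit.
Unset Printing Implicit Defensive.
Import Order.TTheory GRing.Theory Num.Theory.
Import numFieldNormedType.Exports.
Local Open Scope classical_set_scope.
Local Open Scope ring_scope.
Local Open Scope complex_scope.
Local Notation "x ^*" := (Num.conj x) : complex_scope.

(** Write [W(z) = 1 + |z|^2] and [rho(z,s) = |1 + z conj(s)|^2 / (W(z) W(s))].  Everything
reduces to one identity for powers of linear forms in [H_n], [n = p + q],
<<
  C(n,q) <a^p b^q, c^p d^q> = sum_j C(p,j) C(q,j) <a,c>^(p-j) <a,d>^j <b,d>^(q-j) <b,c>^j,
>>
obtained by comparing the coefficients of [t^q] in the reproducing formula
[<a^p b^q, (c + t d)^n> = (<a,c> + t <a,d>)^p (<b,c> + t <b,d>)^q].  The inner products of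
monomials come from integrating total derivatives of [z^a conj(z)^b / W^N] over the plane.

[Im(R_mu)] is spanned by the polarized powers [sigma^mu] of [rho(.,u)], and the identity
expresses [(nu+1) B_nu (sigma^mu)] through the [sigma^l], [l <= mu], with coefficients tending
to [1] for [l = mu] and to [0] for [l < mu].  So [(nu+1) B_nu] tends to the identity on a
finite-dimensional space; hence it is eventually invertible there and its inverse tends to the
identity as well.

[P_k^*] sends the reproducing kernel at [xi] to a multiple of
[(z-w)^k (1 + conj(xi) z)^(mu-k) (1 + conj(xi) w)^(nu-k)].  Integrating out [w] with the same
identity gives
<<
  E^nu_{mu,k} f = k! C(mu,k) / (mu+nu-2k+2)_k
                  * sum_j C(k,j) C(nu-k,j) sum_i (-1)^i C(j,i) B_{mu-k+i} f,
>>
in which only [j = k] survives as [nu -> oo], leaving [E_{mu,k} f]. *)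


(** [BerInv] and [PkAdj] choose their values by [epsilon], so only the defining property may be
    used, and only once a witness is known to exist. For [BerInv] this shapes the perturbation
    argument: a solution must be produced, and every solution shown to be near the limit. The
    monomials over W^mu serve only as a spanning family, so an equation between functions fixes
    coordinates up to linear relations. These relations form a subspace stable under the invertible
    matrix of (nu+1) B_nu, hence under its inverse, which makes the ambiguity harmless.

    The alternating sums over i come from one pairing: the forms (1, conj(xi)) and (s, -1) pair to
    conj(s) - conj(xi), whose squared modulus is W(xi) W(s) (1 - rho(xi,s)), and (1 - rho)^j is
    expanded. The constant in front is C_{mu,nu,k}^2 / C(nu,k), of order nu^-k, against C(nu-k,j) of
    order nu^j. Every B_{mu-k+i} f with i <= k lies in Im(R_mu), so both limits live in one fixed
    finite-dimensional space, and (ii) is (i) with a convergent right-hand side. *)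

(** * Improper integrals on the real line *)

Section RealIntegrals.
Variable R : realType.
Local Notation mu := (@lebesgue_measure R).
Implicit Types (f g : R -> R) (x y : R).

Lemma is_derive_continuous f (df : R -> R) :
  (forall x : R, is_derive x 1 f (df x)) -> continuous f.
Proof.
move=> fd x; apply: differentiable_continuous; apply/derivable1_diffP.
exact: (@ex_derive _ _ _ _ _ _ _ (fd x)).
Qed.

Lemma integral_even_FTC f (F : R -> R) (l : R) :
  (forall x, 0 <= f x) -> continuous f -> (forall x, f (- x) = f x) ->
  (forall x : R, is_derive x 1 F (f x)) -> F 0 = 0 -> F x @[x --> +oo] --> l ->
  (\int[mu]_x (f x)%:E = (2 * l)%:E)%E.
Proof.
move=> f0 cf ef dF F0 Fl.
rewrite ge0_symfun_integralT//; last by move=> x /=; rewrite ef.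
rewrite -set_itvcy (@ge0_continuous_FTC2y _ f F 0 l)//.
- by rewrite F0 sube0 EFinM.
- exact: continuous_subspaceT.
- apply: cvg_at_right_filter.
  exact: (is_derive_continuous dF).
- by move=> x _; rewrite derive1E; apply: (@derive_val _ _ _ _ _ _ _ (dF x)).
Qed.

Lemma integrable_oneDsqrV : mu.-integrable setT (EFin \o (fun x => (1 + x ^+ 2)^-1)).
Proof.
have c : continuous (fun x : R => (1 + x ^+ 2)^-1) by exact: continuous_oneDsqrV.
have p x : 0 <= (1 + x ^+ 2)^-1 by rewrite invr_ge0 addr_ge0 ?sqr_ge0.
apply/integrableP; split.
  by apply/measurable_EFinP; exact: continuous_measurable_fun.
under eq_integral do rewrite /= ger0_norm ?p//.
rewrite (@integral_even_FTC _ (@atan R) (pi / 2))//.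
- by rewrite ltry.
- by move=> x; rewrite sqrrN.
- exact: atan0.
- exact: cvgy_atan.
Qed.

Lemma oneDsqr_gt0 x : 0 < 1 + x ^+ 2.
Proof. by rewrite ltr_pwDl// sqr_ge0. Qed.

Lemma cvg_oneDsqrV_nat (M : R) : M / (1 + n%:R ^+ 2) @[n --> \oo] --> (0 : R).
Proof.
rewrite -[X in _ --> X](mulr0 M); apply: cvgMl_tmp.
apply: (@squeeze_cvgr _ _ _ _ (fun=> 0) (fun n : nat => n.+1%:R^-1)).
- near=> n; rewrite invr_ge0 (ltW (oneDsqr_gt0 _))/= lef_pV2 ?posrE ?oneDsqr_gt0 ?ltr0n//.
  rewrite -natrX -natr1 addrC lerD2l ler_nat.
  by case: (n) => // m; rewrite expnS leq_pmulr// expn1.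
- exact: cvg_cst.
- exact: cvg_harmonic.
Unshelve. all: by end_near. Qed.

(** On [-n, n] the fundamental theorem gives g(n) - g(-n). The bound on [dg] allows dominated
    convergence to the whole line, and the bound on [g] makes the boundary terms vanish. *)
Lemma integral_derive_eq0 g (dg : R -> R) (M : R) :
  (forall x : R, is_derive x 1 g (dg x)) -> continuous dg ->
  (forall x, `|g x| <= M / (1 + x ^+ 2)) ->
  (forall x, `|dg x| <= M / (1 + x ^+ 2)) ->
  (\int[mu]_x (dg x)%:E = 0)%E.
Proof.
move=> gd cdg gM dgM.
have mdg : measurable_fun setT dg by exact: continuous_measurable_fun.
pose f_ (n : nat) x := ((dg \_ `[- n%:R, n%:R]) x)%:E.
have mf_ n : measurable_fun setT (f_ n).
  apply/measurable_EFinP.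
  by apply/measurable_restrict => //; apply: measurable_funTS.
have ig : mu.-integrable setT (EFin \o (fun x => M / (1 + x ^+ 2))).
  have -> : EFin \o (fun x => M / (1 + x ^+ 2)) =
            (fun x => M%:E * (EFin \o (fun x => (1 + x ^+ 2)^-1)%R) x)%E.
    by apply/funext => x /=; rewrite EFinM.
  by apply: integrableZl => //; exact: integrable_oneDsqrV.
have [|||_ _] := @dominated_convergence _ _ _ mu setT measurableT f_
   (EFin \o dg) _ mf_ _ _ ig _.
- exact/measurable_EFinP.
- apply/aeW => x _.
  apply: cvg_near_cst; near=> n; rewrite /f_ /= patchE mem_set//=.
  rewrite in_itv/= -ler_norml.
  near: n; exact: nbhs_infty_ger.
- apply/aeW => x n _; rewrite /f_ patchE /=; case: ifPn => _.
    by rewrite lee_fin.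
  by rewrite normr0 lee_fin (le_trans _ (dgM x)).
move=> cv.
have e n : (\int[mu]_x f_ n x = (g n%:R - g (- n%:R))%:E)%E.
  rewrite (_ : f_ n = (EFin \o dg) \_ `[- n%:R, n%:R]); last by rewrite restrict_EFin.
  rewrite -integral_mkcond.
  (* For n = 0 the interval is a point, which the fundamental theorem excludes. *)
  case: n => [|n]; first by rewrite oppr0 set_itv1 integral_set1 subrr.
  rewrite (@continuous_FTC2 _ dg g) ?EFinB//.
  - by rewrite (@lt_trans _ _ 0)// oppr_lt0.
  - exact: continuous_subspaceT.
  - split.
    + by move=> x _; apply: (@ex_derive _ _ _ _ _ _ _ (gd x)).
    + apply: cvg_at_right_filter; exact: (is_derive_continuous gd).
    + apply: cvg_at_left_filter; exact: (is_derive_continuous gd).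
  - by move=> x _; rewrite derive1E; apply: (@derive_val _ _ _ _ _ _ _ (gd x)).
have g0 : g n%:R - g (- n%:R) @[n --> \oo] --> (0 : R).
  rewrite -[X in _ --> X](subrr (0:R)).
  apply: cvgB; apply/cvgr0Pnorm_le => e0 ep.
  - have /cvgr0Pnorm_le/(_ _ ep) := @cvg_oneDsqrV_nat M.
    apply: filterS => n h; apply: (le_trans (gM _)).
    by apply: le_trans h; rewrite ler_norm.
  - have /cvgr0Pnorm_le/(_ _ ep) := @cvg_oneDsqrV_nat M.
    apply: filterS => n h; apply: (le_trans (gM _)).
    by rewrite sqrrN; apply: le_trans h; rewrite ler_norm.
apply: (cvg_unique _ cv) => //.
rewrite (_ : (fun n => _) = EFin \o (fun n : nat => g n%:R - g (- n%:R))); last first.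
  by apply/funext => n; rewrite /= e.
rewrite /=; apply: (@cvg_comp _ _ _ (fun n : nat => g n%:R - g (- n%:R)) EFin _ _ _ g0).
exact: cvg_id.
Unshelve. all: by end_near. Qed.

(** The inner integral of W^-2 on a vertical line, where c = 1 + x^2. *)
Lemma integral_quartic (c : R) : 0 < c ->
  (\int[mu]_x (((c + x ^+ 2) ^- 2)%:E) = (pi / 2 / (c * Num.sqrt c))%:E)%E.
Proof.
move=> c0; set s := Num.sqrt c.
have s0 : 0 < s by rewrite sqrtr_gt0.
have sc : s ^+ 2 = c by rewrite sqr_sqrtr// ltW.
have p x : 0 < c + x ^+ 2 by rewrite ltr_pwDl// sqr_ge0.
have dq x : is_derive x 1 (fun y : R => c + y ^+ 2) (2 * x).
  by apply: is_derive_eq; rewrite /GRing.scale/=; ring.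
have cq : continuous (fun y : R => (c + y ^+ 2) ^- 2).
  move=> x; apply: (@cvgV _ _ _ _ (fun y : R => (c + y ^+ 2) ^+ 2)).
    by rewrite expf_neq0// lt0r_neq0.
  apply: (@continuous_comp _ _ _ (fun y : R => c + y ^+ 2) (fun y => y ^+ 2)).
    exact: (is_derive_continuous dq).
  exact: exprn_continuous.
(* The antiderivative vanishing at 0; at infinity only the arctangent term contributes. *)
pose F y := y * ((2 * c) * (c + y ^+ 2))^-1 + (2 * c * s)^-1 * atan (s^-1 * y).
have dF x : is_derive x 1 F ((c + x ^+ 2) ^- 2).
  have d1 : is_derive x 1 (fun y : R => ((2 * c) * (c + y ^+ 2))^-1)
      (- ((2 * c) * (c + x ^+ 2)) ^- 2 *: (2 * c * (2 * x))).
    by apply: is_deriveV; rewrite !mulf_neq0 ?lt0r_neq0.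
  have d2 : is_derive x 1 (@atan R \o (fun y => s^-1 * y))
      ((1 + (s^-1 * x) ^+ 2)^-1 * s^-1).
    apply: is_derive1_comp.
    rewrite -[X in is_derive _ _ _ X]mulr1.
    exact: (@is_deriveZ _ _ _ id (s^-1) _ _ _ (is_derive_id _ _)).
  have -> : (c + x ^+ 2) ^- 2 = (x *: (- ((2 * c) * (c + x ^+ 2)) ^- 2 *: (2 * c * (2 * x)))
     + ((2 * c) * (c + x ^+ 2))^-1 *: 1)
     + (2 * c * s)^-1 * ((1 + (s^-1 * x) ^+ 2)^-1 * s^-1).
    rewrite /GRing.scale/=.
    have e1 : s^-1 ^+ 2 = c^-1 by rewrite exprVn sc.
    rewrite [(s^-1 * x)^+2]exprMn e1.
    rewrite [(2 * c * s)^-1]invfM.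
    have -> : (2 * c)^-1 / s * ((1 + c^-1 * x ^+ 2)^-1 / s) =
       (2 * c)^-1 * (s^-1 ^+ 2) * (1 + c^-1 * x ^+ 2)^-1 by rewrite expr2; ring.
    rewrite e1; field; rewrite ?lt0r_neq0 ?p//=.
  exact: (is_deriveD (is_deriveM (is_derive_id x 1) d1) (is_deriveZ ((2 * c * s)^-1) d2)).
rewrite (@integral_even_FTC _ F (pi / 2 / (2 * c * s)) _ cq _ dF).
- congr EFin; field.
  by rewrite ?lt0r_neq0 //.
- by move=> x; rewrite invr_ge0 sqr_ge0.
- by move=> x; rewrite sqrrN.
- by rewrite /F mul0r mulr0 atan0 mulr0 addr0.
- rewrite -[X in _ --> X]add0r; apply: cvgD.
    apply: (@squeeze_cvgr _ _ _ _ (fun=> 0) (fun y => (2 * c)^-1 * y^-1)).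
    + near=> y.
      have y0 : 0 < y by near: y; exact: nbhs_pinfty_gt.
      apply/andP; split.
        by rewrite divr_ge0 ?mulr_ge0 ?(ltW y0) ?(ltW c0) ?(ltW (p y)).
      rewrite invfM mulrCA ler_pM2l ?invr_gt0 ?mulr_gt0//.
      rewrite ler_pdivrMr// mulrC ler_pdivlMr// -expr2.
      by rewrite lerDr ltW.
    + exact: cvg_cst.
    + rewrite -[X in _ --> X](mulr0 (2 * c)^-1); apply: cvgMl_tmp.
      apply/cvgr0Pnorm_le => e e0; near=> y.
      have y0 : 0 < y by near: y; exact: nbhs_pinfty_gt.
      have h : e^-1 <= y by near: y; apply: nbhs_pinfty_ge; exact: num_real.
      by rewrite ger0_norm ?invr_ge0 ?(ltW y0)// invf_ple ?posrE.
  rewrite [X in _ --> X]mulrC; apply: cvgMl_tmp.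
  apply: (@cvg_comp _ _ _ (fun y => s^-1 * y) (@atan R) _ (+oo)%R); last exact: cvgy_atan.
  apply: gt0_cvgMry; last exact: cvg_id.
  by rewrite invr_gt0.
Unshelve. all: by end_near. Qed.

(** The antiderivative is sin (atan x) = x / sqrt (1 + x^2), with limit 1. This is the outer
    integral of W^-2 that [integral_quartic] leaves. *)
Lemma integral_sesqui :
  (\int[mu]_x (((1 + x ^+ 2) * Num.sqrt (1 + x ^+ 2))^-1)%:E = 2%:E)%E.
Proof.
have d x : is_derive x 1 (fun y => sin (atan y))
    (((1 + x ^+ 2) * Num.sqrt (1 + x ^+ 2))^-1).
  have -> : ((1 + x ^+ 2) * Num.sqrt (1 + x ^+ 2))^-1 = cos (atan x) * (1 + x ^+ 2)^-1.
    by rewrite cos_atan invfM mulrC.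
  apply: (@is_derive1_comp _ sin (@atan R)).
rewrite (@integral_even_FTC _ (fun y => sin (atan y)) 1 _ _ _ d) ?mulr1//.
- by move=> x; rewrite invr_ge0 mulr_ge0 ?sqrtr_ge0 ?(ltW (oneDsqr_gt0 _)).
- have -> : (fun x => ((1 + x ^+ 2) * Num.sqrt (1 + x ^+ 2))^-1) =
     (fun x => (1 + x ^+ 2)^-1 * cos (atan x)).
    by apply/funext => x; rewrite cos_atan invfM.
  move=> x; apply: cvgM; first exact: continuous_oneDsqrV.
  apply: (@continuous_comp _ _ _ (@atan R) cos); first exact: continuous_atan.
  exact: continuous_cos.
- by move=> x; rewrite sqrrN.
- by rewrite atan0 sin0.
- rewrite -(@sin_pihalf R).
  apply: (@cvg_comp _ _ _ (@atan R) sin _ (nbhs (pi / 2))); first exact: cvgy_atan.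
  exact: continuous_sin.
Qed.

End RealIntegrals.

(** * The real-valued modulus and the weight W *)

Section Modulus.
Variable R : realType.
Local Notation C := R[i].
Implicit Types (z w : C).

(** [normc] is real-valued while the norm of the library takes values in C; the laws of the norm are
    carried over through this equality. *)
Lemma modcE z : (normc z)%:C = `|z|.
Proof. by rewrite normc_def. Qed.

Lemma modcM z w : normc (z * w) = normc z * normc w.
Proof. by apply: complexI; rewrite rmorphM /= !modcE normrM. Qed.

Lemma modcX z n : normc (z ^+ n) = normc z ^+ n.
Proof. by apply: complexI; rewrite rmorphXn /= !modcE normrX. Qed.

Lemma modcD z w : normc (z + w) <= normc z + normc w.
Proof. by rewrite -lecR rmorphD /= !modcE ler_normD. Qed.

Lemma modc_sum (I : finType) (F : I -> C) :
  normc (\sum_i F i) <= \sum_i normc (F i).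
Proof.
rewrite -lecR rmorph_sum /= modcE.
by under [X in _ <= X]eq_bigr do rewrite modcE; exact: ler_norm_sum.
Qed.

Lemma modcN z : normc (- z) = normc z.
Proof. by apply: complexI; rewrite !modcE normrN. Qed.

Lemma modcJ z : normc (z^*) = normc z.
Proof. by apply: complexI; rewrite !modcE norm_conjC. Qed.

Lemma conj_real (r : R) : (r%:C)^* = r%:C.
Proof. exact: conjc_real. Qed.

Lemma modc_ge0 z : 0 <= normc z.
Proof. exact: sqrtr_ge0. Qed.

Lemma modc_real (r : R) : normc (r%:C) = `|r|.
Proof. by rewrite /normc /nsq /= expr0n /= addr0 sqrtr_sqr. Qed.

Lemma modc0 : normc (0 : C) = 0.
Proof. by rewrite -[0 : C]/(0%:C) modc_real normr0. Qed.

Lemma modc1 : normc (1 : C) = 1.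
Proof. by rewrite -[1 : C]/(1%:C) modc_real normr1. Qed.

Lemma modc_eq0 z : (normc z == 0) = (z == 0).
Proof. by rewrite -(inj_eq (@complexI R)) modcE normr_eq0. Qed.

Lemma Re_le_modc z : `|complex.Re z| <= normc z.
Proof. by rewrite -lecR modcE normc_ge_Re. Qed.

Lemma Im_le_modc z : `|complex.Im z| <= normc z.
Proof.
rewrite -(modcJ z) -[normc _]mul1r -modc1.
have -> : complex.Im z = complex.Re ('i%C * z^*) by case: z => a b /=; ring.
apply: (le_trans (Re_le_modc _)); rewrite modcM modc1.
by rewrite (_ : normc 'i%C = 1)// /normc /nsq /= expr0n /= add0r expr1n sqrtr1.
Qed.

Lemma sqr_modc z : normc z ^+ 2 = nsq z.
Proof. by rewrite sqr_sqrtr// addr_ge0 ?sqr_ge0. Qed.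

Lemma wt_ge1 z : 1 <= wt z.
Proof. by rewrite lerDl addr_ge0 ?sqr_ge0. Qed.

Lemma wt_gt0 z : 0 < wt z.
Proof. by rewrite (lt_le_trans ltr01) ?wt_ge1. Qed.

Lemma wt_neq0 z : wt z != 0. Proof. exact/lt0r_neq0/wt_gt0. Qed.

Lemma wtC z : (wt z)%:C = 1 + z * z^*.
Proof.
by case: z => a b; apply/eqP; rewrite eq_complex /wt /nsq /=; apply/andP; split; apply/eqP; ring.
Qed.

Lemma wtC_neq0 z : (wt z)%:C != 0.
Proof. by rewrite (inj_eq (@complexI R)) wt_neq0. Qed.

(** The square root of W dominates |z|, so growth of any order, odd ones included, is measured by
    powers of one function. *)
Definition hw z : R := Num.sqrt (wt z).

Lemma hw_ge1 z : 1 <= hw z.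
Proof. by rewrite -(@sqrtr1 R) ler_wsqrtr ?wt_ge1. Qed.

Lemma hw_gt0 z : 0 < hw z.
Proof. exact: lt_le_trans (hw_ge1 z). Qed.

Lemma hw_sqr z : hw z ^+ 2 = wt z.
Proof. by rewrite sqr_sqrtr// ltW// wt_gt0. Qed.

Lemma modc_le_hw z : normc z <= hw z.
Proof. by rewrite ler_wsqrtr// lerDr. Qed.

End Modulus.

(** * Measurability and linearity of the plane integral *)

Section ComplexIntegral.
Variable R : realType.
Local Notation C := R[i].
Local Notation mu := (@lebesgue_measure R).
Implicit Types (f g h : C -> C).

Definition rmeas (h : C -> R) :=
  measurable_fun setT (fun p : R * R => h (p.1 +i* p.2)).
Definition cmeas g :=
  rmeas (fun z => complex.Re (g z)) /\ rmeas (fun z => complex.Im (g z)).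

Lemma cmeas_cst (a : C) : cmeas (fun=> a).
Proof. by split; exact: measurable_cst. Qed.

Lemma cmeas_id : cmeas id.
Proof. by split; rewrite /rmeas /=; [exact: measurable_fst|exact: measurable_snd]. Qed.

Lemma cmeasD f g : cmeas f -> cmeas g -> cmeas (fun z => f z + g z).
Proof.
move=> [f1 f2] [g1 g2]; split; rewrite /rmeas.
  rewrite (_ : (fun p => _) = (fun p : R * R => complex.Re (f (p.1 +i* p.2)) +
    complex.Re (g (p.1 +i* p.2)))); first exact: measurable_funD.
  by apply/funext => p; rewrite raddfD.
rewrite (_ : (fun p => _) = (fun p : R * R => complex.Im (f (p.1 +i* p.2)) +
    complex.Im (g (p.1 +i* p.2)))); first exact: measurable_funD.
by apply/funext => p; rewrite raddfD.
Qed.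

Lemma ReM (z w : C) :
  complex.Re (z * w) = complex.Re z * complex.Re w - complex.Im z * complex.Im w.
Proof. by case: z w => [a b] [c d]. Qed.

Lemma ImM (z w : C) :
  complex.Im (z * w) = complex.Re z * complex.Im w + complex.Im z * complex.Re w.
Proof. by case: z w => [a b] [c d]. Qed.

Lemma cmeasM f g : cmeas f -> cmeas g -> cmeas (fun z => f z * g z).
Proof.
move=> [f1 f2] [g1 g2]; split; rewrite /rmeas.
  under eq_fun do rewrite ReM.
  by apply: measurable_funB; exact: measurable_funM.
under eq_fun do rewrite ImM.
by apply: measurable_funD; exact: measurable_funM.
Qed.

Lemma cmeasX f n : cmeas f -> cmeas (fun z => f z ^+ n).
Proof.
move=> mf; elim: n => [|n ih]; first exact: cmeas_cst.
by under eq_fun do rewrite exprS; exact: cmeasM.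
Qed.

Lemma cmeasJ f : cmeas f -> cmeas (fun z => (f z)^*).
Proof.
move=> [f1 f2]; split; rewrite /rmeas.
  by rewrite (_ : (fun p => _) = (fun p : R * R => complex.Re (f (p.1 +i* p.2))));
    last by apply/funext => p; case: (f _).
rewrite (_ : (fun p => _) = (fun p : R * R => - complex.Im (f (p.1 +i* p.2))));
    last by apply/funext => p; case: (f _).
exact: measurable_funN.
Qed.

Lemma continuous_inv_pos (e : R) : 0 < e ->
  continuous (fun x : R => (Num.max e x)^-1).
Proof.
move=> e0 x; apply: (@cvgV _ _ _ _ (fun y : R => Num.max e y)).
  by rewrite lt0r_neq0// lt_max e0.
by apply: continuous_max => //; exact: cst_continuous.
Qed.

Lemma rmeas_wtV : rmeas (fun z => (wt z)^-1).
Proof.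
(* Since W >= 1, inversion may be replaced by x -> 1 / max(1, x), which is continuous on all of
   R. *)
rewrite /rmeas (_ : (fun p => _) = (fun x : R => (Num.max 1 x)^-1) \o
   (fun p : R * R => 1 + (p.1 ^+ 2 + p.2 ^+ 2))); last first.
  apply/funext => p /=; congr (_^-1).
  by rewrite (max_idPr _)// -[1 + _]/(wt (p.1 +i* p.2)) wt_ge1.
apply: measurableT_comp.
  by apply: continuous_measurable_fun; exact: continuous_inv_pos.
apply: measurable_funD; first exact: measurable_cst.
by apply: measurable_funD; apply: measurable_funX;
  [exact: measurable_fst|exact: measurable_snd].
Qed.

Lemma cmeas_wtV : cmeas (fun z => (wt z)^-1%:C).
Proof. by split; [exact: rmeas_wtV|exact: measurable_cst]. Qed.

Lemma wtVX (z : C) n : (wt z ^- n)%:C = (wt z)^-1%:C ^+ n.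
Proof. by rewrite -exprVn rmorphXn. Qed.

Definition cintegr g :=
  (mu \x mu)%E.-integrable setT
     (EFin \o (fun p : R * R => complex.Re (g (p.1 +i* p.2)))) /\
  (mu \x mu)%E.-integrable setT
     (EFin \o (fun p : R * R => complex.Im (g (p.1 +i* p.2)))).

Lemma integrable_lin (u v : R * R -> R) (a b : R) :
  (mu \x mu)%E.-integrable setT (EFin \o u) ->
  (mu \x mu)%E.-integrable setT (EFin \o v) ->
  (mu \x mu)%E.-integrable setT (EFin \o (fun p => a * u p + b * v p)).
Proof.
move=> iu iv.
rewrite (_ : EFin \o _ =
   ((fun p => a%:E * (EFin \o u) p) \+ (fun p => b%:E * (EFin \o v) p))%E); last first.
  by apply/funext => p; rewrite /= EFinD !EFinM.
by apply: integrableD => //; exact: integrableZl.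
Qed.

Lemma Rintegral_lin (u v : R * R -> R) (a b : R) :
  (mu \x mu)%E.-integrable setT (EFin \o u) ->
  (mu \x mu)%E.-integrable setT (EFin \o v) ->
  Rintegral (mu \x mu)%E setT (fun p => a * u p + b * v p) =
  a * Rintegral (mu \x mu)%E setT u + b * Rintegral (mu \x mu)%E setT v.
Proof.
move=> iu iv.
have z0 : (mu \x mu)%E.-integrable setT (EFin \o (fun=> 0 : R) : R * R -> _).
  by apply: integrable0.
have izl w r : (mu \x mu)%E.-integrable setT (EFin \o w) ->
  (mu \x mu)%E.-integrable setT (EFin \o (fun p => r * w p)).
  move=> iw; have := integrable_lin r 0 iw z0.
  by congr (integrable _ _ (EFin \o _)); apply/funext => p; rewrite mulr0 addr0.
rewrite RintegralD//; [|exact: izl..].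
by rewrite !RintegralZl.
Qed.

Lemma cintegrZ (a : C) g : cintegr g -> cintegr (fun z => a * g z).
Proof.
move=> [g1 g2]; split.
  have := integrable_lin (complex.Re a) (- complex.Im a) g1 g2.
  by congr (integrable _ _ (EFin \o _)); apply/funext => p; rewrite ReM mulNr.
have := integrable_lin (complex.Re a) (complex.Im a) g2 g1.
by congr (integrable _ _ (EFin \o _)); apply/funext => p; rewrite ImM.
Qed.

Lemma cintD f g : cintegr f -> cintegr g ->
  cint (fun z => f z + g z) = cint f + cint g.
Proof.
move=> [f1 f2] [g1 g2]; rewrite /cint /leb2.
apply/eqP; rewrite eq_complex /=; apply/andP; split; apply/eqP.
  under eq_Rintegral do rewrite raddfD /=.
  by rewrite RintegralD.
under eq_Rintegral do rewrite raddfD /=.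
by rewrite RintegralD.
Qed.

Lemma cintZ (a : C) g : cintegr g -> cint (fun z => a * g z) = a * cint g.
Proof.
move=> [g1 g2]; rewrite /cint /leb2.
apply/eqP; rewrite eq_complex ReM ImM /=; apply/andP; split; apply/eqP.
  under eq_Rintegral do rewrite ReM -mulNr.
  by rewrite Rintegral_lin// mulNr.
under eq_Rintegral do rewrite ImM.
by rewrite Rintegral_lin.
Qed.

End ComplexIntegral.

(** * Continuous functions on the sphere: measurability and boundedness *)

Section Continuous.
Variable R : realType.
Local Notation C := R[i].

(** Such a set is the countable union of the boxes it contains with rational centre and half-width
    1/(n+1), and boxes belong to the product sigma-algebra. *)
Lemma open_plane_measurable (A : set (R * R)) :
  (forall p, A p -> exists2 d : R, 0 < d &
     forall q, `|q.1 - p.1| < d -> `|q.2 - p.2| < d -> A q) -> measurable A.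
Proof.
move=> oA.
pose box (t : rat * rat * nat) : set (R * R) :=
  [set x | `|x - ratr t.1.1| < t.2.+1%:R^-1] `*` [set x | `|x - ratr t.1.2| < t.2.+1%:R^-1].
pose F t := if `[< box t `<=` A >] then box t else set0.
have mbox t : measurable (box t).
  have mb (c e : R) : measurable [set x : R | `|x - c| < e].
    rewrite (_ : [set x | _] = ball c e); first exact: measurable_ball.
    by apply/seteqP; split=> x /=; rewrite /ball /= distrC.
  by apply: measurableX; exact: mb.
suff -> : A = \bigcup_t F t.
  apply: countable_bigcupT_measurable; first exact: countableP.
  by move=> t; rewrite /F; case: asboolP.
apply/seteqP; split => [p Ap|p [t _]]; last by rewrite /F; case: asboolP => // h /h.
have [d d0 hd] := oA _ Ap.
have [n hn] : exists n : nat, n.+1%:R^-1 < d / 2.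
  exists (Num.truncn (d / 2)^-1); rewrite invf_plt ?posrE ?divr_gt0//.
  by rewrite truncnS_gt.
have n0 : (0 : R) < n.+1%:R^-1 by rewrite invr_gt0 ltr0n.
have approx (x : R) : exists q : rat, `|x - ratr q| < n.+1%:R^-1.
  have [|q] := @rat_in_itvoo R (x - n.+1%:R^-1) (x + n.+1%:R^-1).
    by rewrite ltrD2l gtrN.
  by rewrite in_itv /= => /andP[a b]; exists q; rewrite distrC ltr_distl a.
have [q1 h1] := approx p.1; have [q2 h2] := approx p.2.
exists ((q1, q2), n) => //; rewrite /F; case: asboolP => [_ //|]; case.
move=> q /= [a b]; apply: hd.
  rewrite (_ : q.1 - p.1 = (q.1 - ratr q1) - (p.1 - ratr q1)); last by ring.
  apply: (le_lt_trans (ler_normB _ _)).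
  by rewrite (splitr d) ltrD// (lt_trans _ hn).
rewrite (_ : q.2 - p.2 = (q.2 - ratr q2) - (p.2 - ratr q2)); last by ring.
apply: (le_lt_trans (ler_normB _ _)).
by rewrite (splitr d) ltrD// (lt_trans _ hn).
Qed.

Lemma modc_le_sum (a b : R) : normc (a +i* b) <= `|a| + `|b|.
Proof.
rewrite -(ler_pXn2r (ltn0Sn 1)) ?nnegrE ?modc_ge0 ?addr_ge0//.
rewrite sqr_modc /nsq /= -(real_normK (num_real a)) -(real_normK (num_real b)).
by rewrite sqrrD lerD2r lerDl mulrn_wge0 ?mulr_ge0.
Qed.

Lemma rmeas_of_cont (h : C -> R) :
  (forall z (e : R), 0 < e -> exists2 d : R, 0 < d &
      forall w, normc (w - z) < d -> `|h w - h z| < e) -> rmeas h.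
Proof.
move=> ch; apply: (measurability _ (RGenOpens.measurableE R)) => _ [_ [a [b ->] <-]].
rewrite setTI; apply: open_plane_measurable => p /=.
rewrite in_itv /= => /andP[ap pb].
set z := p.1 +i* p.2.
have e0 : 0 < Num.min (h z - a) (b - h z) by rewrite lt_min !subr_gt0 ap pb.
have [d d0 hd] := ch z _ e0.
exists (d / 2); first by rewrite divr_gt0.
move=> q q1 q2 /=; rewrite in_itv /=.
have := hd (q.1 +i* q.2) _.
have -> : q.1 +i* q.2 - z = (q.1 - p.1) +i* (q.2 - p.2) by [].
rewrite lt_min => /(_ _)/andP[].
  by apply: (le_lt_trans (modc_le_sum _ _)); rewrite (splitr d) ltrD.
rewrite !ltr_norml => /andP[h1 h2] /andP[h3 h4]; apply/andP; split; lra.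
Qed.

Lemma CP1cont_cmeas (f : C -> C) : CP1cont f -> cmeas f.
Proof.
move=> [cf _]; split; apply: rmeas_of_cont => z e e0; have [d d0 hd] := cf z e e0;
  exists d => // w /hd; apply: le_lt_trans.
  by rewrite -raddfB Re_le_modc.
by rewrite -raddfB Im_le_modc.
Qed.

Lemma lerB_dist_modc (z w : C) : `|normc z - normc w| <= normc (z - w).
Proof.
rewrite ler_norml; apply/andP.
by have := modcD (z - w) w; have := modcD (w - z) z; rewrite !subrK -(modcN (w - z)) opprB => h1 h2; split; lra.
Qed.

(** Far out the values stay within 1 of the limit at infinity; the remaining points lie in a compact
    square. *)
Lemma CP1cont_bounded (f : C -> C) : CP1cont f -> exists M, forall z, normc (f z) <= M.
Proof.
move=> [cf [L /(_ 1 ltr01)[M0 hM]]].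
pose M := Num.max M0 0.
pose K : set (R * R) := `[- M, M] `*` `[- M, M].
have cK : compact K by apply: compact_setX; exact: segment_compact.
pose F (p : R * R) : R := normc (f (p.1 +i* p.2)).
have cF : continuous F.
  move=> p; apply/cvgrPdist_lt => e e0.
  have [d d0 hd] := cf (p.1 +i* p.2) e e0.
  apply: filterS (nbhsx_ballx p (d / 2) _); last by rewrite divr_gt0.
  move=> q [q1 q2]; apply: le_lt_trans (hd (q.1 +i* q.2) _).
    apply: (le_trans (lerB_dist_modc _ _)); rewrite -modcN opprB.
    by [].
  have -> : (q.1 +i* q.2) - (p.1 +i* p.2) = (q.1 - p.1) +i* (q.2 - p.2) by [].
  apply: (le_lt_trans (modc_le_sum _ _)).
  by rewrite (splitr d) ltrD// distrC.
have [B hB] : exists B, forall p, K p -> F p <= B.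
  have /compact_bounded[B [_ hB]] : compact (F @` K).
    by apply: continuous_compact => //; exact: continuous_subspaceT.
  exists (B + 1) => p Kp; apply: (le_trans (ler_norm _)).
  by apply: (hB (B + 1)); [rewrite ltrDl|exists p].
exists (Num.max B (normc L + 1)) => z; rewrite le_max.
have [zM|zM] := leP (normc z) M; last first.
  apply/orP; right.
  rewrite -[f z](subrK L) addrC; apply: (le_trans (modcD _ _)).
  by rewrite lerD2l ltW// hM// (le_lt_trans _ zM)// le_max lexx.
apply/orP; left; case: z zM => a b zM; apply: (hB (a, b)).
split => /=; rewrite in_itv /= -ler_norml; apply: le_trans zM.
  exact: (Re_le_modc (a +i* b)).
exact: (Im_le_modc (a +i* b)).
Qed.

End Continuous.

(** * Integrability against the measures iota_tau *)

Section Admissible.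
Variable R : realType.
Local Notation C := R[i].
Local Notation mu := (@lebesgue_measure R).
Implicit Types (f g h : C -> C).

Lemma measurable_wtX n :
  measurable_fun setT (fun p : R * R => wt (p.1 +i* p.2) ^- n).
Proof.
under eq_fun do rewrite -exprVn.
by apply: measurable_funX; exact: rmeas_wtV.
Qed.

(** Integrating in y leaves (pi / 2) (1 + x^2)^(-3/2), whose integral in x is pi. *)
Lemma integral_wt2 :
  (\int[mu \x mu]_p ((wt (p.1 +i* p.2) ^- 2)%:E) = (@pi R)%:E)%E.
Proof.
rewrite fubini_tonelli1; last 2 first.
- by apply/measurable_EFinP; exact: measurable_wtX.
- by move=> p; rewrite lee_fin invr_ge0 sqr_ge0.
rewrite /fubini_F /=.
under eq_integral => x _.
  under eq_integral => y _ do rewrite /wt /nsq /= addrA.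
  rewrite integral_quartic ?oneDsqr_gt0// EFinM.
  over.
rewrite /= ge0_integralZl_EFin//.
- by rewrite integral_sesqui -EFinM mulfVK.
- by move=> x _; rewrite lee_fin invr_ge0 mulr_ge0 ?sqrtr_ge0// ltW// oneDsqr_gt0.
- apply/measurable_EFinP.
  have -> : (fun x : R => ((1 + x ^+ 2) * Num.sqrt (1 + x ^+ 2))^-1) =
     (fun x => (1 + x ^+ 2)^-1 * cos (atan x)).
    by apply/funext => x; rewrite cos_atan invfM.
  apply: continuous_measurable_fun.
  move=> x; apply: cvgM; first exact: continuous_oneDsqrV.
  apply: (@continuous_comp _ _ _ (@atan R) cos); first exact: continuous_atan.
  exact: continuous_cos.
- by rewrite divr_ge0// pi_ge0.
Qed.

Lemma integrable_wt2 :
  (mu \x mu)%E.-integrable setT (EFin \o (fun p : R * R => wt (p.1 +i* p.2) ^- 2)).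
Proof.
apply/integrableP; split; first by apply/measurable_EFinP; exact: measurable_wtX.
under eq_integral do rewrite /= ger0_norm ?invr_ge0 ?sqr_ge0//.
by rewrite integral_wt2 ltry.
Qed.

Lemma rintegr_dom (h : C -> R) (M : R) : rmeas h ->
  (forall z, `|h z| <= M * wt z ^- 2) ->
  (mu \x mu)%E.-integrable setT (EFin \o (fun p : R * R => h (p.1 +i* p.2))).
Proof.
move=> mh hM.
have := @integrableZl _ _ _ (mu \x mu)%E setT measurableT M _ integrable_wt2.
apply: le_integrable => //; first exact/measurable_EFinP.
move=> p _ /=; rewrite lee_fin; apply: (le_trans (hM _)).
exact: ler_norm.
Qed.

Lemma cintegr_dom g (M : R) : cmeas g ->
  (forall z, normc (g z) <= M * wt z ^- 2) -> cintegr g.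
Proof.
move=> [m1 m2] gM; split.
  apply: (rintegr_dom m1 (M := M)) => z; apply: le_trans (gM z).
  exact: Re_le_modc.
apply: (rintegr_dom m2 (M := M)) => z; apply: le_trans (gM z).
exact: Im_le_modc.
Qed.

(* Growth of order |z|^n at infinity: for n <= 2 tau such a g is integrable against
   iota_tau. *)
Definition adm n g := cmeas g /\ exists M, forall z, normc (g z) <= M * hw z ^+ n.

Lemma adm_cst (a : C) : adm 0 (fun=> a).
Proof. by split; [exact: cmeas_cst|exists (normc a) => z; rewrite mulr1]. Qed.

Lemma adm_id : adm 1 id.
Proof. by split; [exact: cmeas_id|exists 1 => z; rewrite mul1r; exact: modc_le_hw]. Qed.

Lemma admJ n g : adm n g -> adm n (fun z => (g z)^*).
Proof.
move=> [mg [M gM]]; split; first exact: cmeasJ.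
by exists M => z; rewrite modcJ.
Qed.

Lemma adm_bnd_ge0 n g M : (forall z, normc (g z) <= M * hw z ^+ n) -> 0 <= M.
Proof.
move=> /(_ 0); move=> /(le_trans (modc_ge0 _)).
by rewrite pmulr_lge0// exprn_gt0// hw_gt0.
Qed.

Lemma adm_le m n g : (m <= n)%N -> adm m g -> adm n g.
Proof.
move=> mn [mg [M gM]]; split=> //; exists M => z; apply: (le_trans (gM z)).
by rewrite ler_wpM2l ?(adm_bnd_ge0 gM)// ler_weXn2l// hw_ge1.
Qed.

Lemma admD n f g : adm n f -> adm n g -> adm n (fun z => f z + g z).
Proof.
move=> [mf [M fM]] [mg [N gN]]; split; first exact: cmeasD.
exists (M + N) => z; rewrite mulrDl; apply: (le_trans (modcD _ _)).
by rewrite lerD.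
Qed.

Lemma admM m n f g : adm m f -> adm n g -> adm (m + n) (fun z => f z * g z).
Proof.
move=> [mf [M fM]] [mg [N gN]]; split; first exact: cmeasM.
exists (M * N) => z; rewrite modcM exprD mulrACA.
by apply: ler_pM; rewrite ?modc_ge0.
Qed.

Lemma admZ n (a : C) g : adm n g -> adm n (fun z => a * g z).
Proof. exact: (@admM 0 n _ _ (adm_cst a)). Qed.

Lemma admX n k g : adm n g -> adm (k * n) (fun z => g z ^+ k).
Proof.
move=> ag; elim: k => [|k ih]; first exact: adm_cst.
by under eq_fun do rewrite exprS; rewrite mulSn; exact: admM.
Qed.

Lemma adm_sum n (I : Type) (r : seq I) (P : pred I) (F : I -> C -> C) :
  (forall i, P i -> adm n (F i)) -> adm n (fun z => \sum_(i <- r | P i) F i z).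
Proof.
move=> aF; elim: r => [|i r ih].
  under eq_fun do rewrite big_nil.
  exact: adm_le (adm_cst 0).
under eq_fun do rewrite big_cons.
by case: (boolP (P i)) => // Pi; apply: admD => //; exact: aF.
Qed.

Lemma adm_mono a b : adm (a + b) (fun z => z ^+ a * z^* ^+ b).
Proof.
apply: admM; first by have := admX a adm_id; rewrite muln1.
by have := admX b (admJ adm_id); rewrite muln1.
Qed.

Lemma adm_poly n (p : {poly C}) : (size p <= n.+1)%N -> adm n (fun z => p.[z]).
Proof.
move=> sp; under eq_fun do rewrite (horner_coef_wide _ sp).
apply: adm_sum => i _; apply: admZ.
have := admX i adm_id; rewrite muln1; apply: adm_le.
by rewrite -ltnS ltn_ord.
Qed.

Lemma adm_CP1 f : CP1cont f -> adm 0 f.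
Proof.
move=> cf; split; first exact: CP1cont_cmeas.
have [M hM] := CP1cont_bounded cf.
by exists M => z; rewrite mulr1.
Qed.

(** The density of iota_tau is a constant times W^-(tau+2), and hw^(2 tau) = W^tau, so the product
    is dominated by the integrable function W^-2. *)
Lemma adm_cintegr tau g : adm (2 * tau) g ->
  cintegr (fun z => g z * (iota_dens tau z)%:C).
Proof.
move=> [mg [M gM]].
have dE (z : C) : (iota_dens tau z)%:C = (tau.+1%:R / pi)%:C * (wt z)^-1%:C ^+ (tau + 2).
  rewrite -wtVX -rmorphM /=; congr (_%:C).
  rewrite /iota_dens exprD; have := lt0r_neq0 (pi_gt0 R).
  move: (pi : R) => q q0; field.
  by rewrite ?expf_neq0 ?wt_neq0 ?q0.
apply: (@cintegr_dom _ (M * (tau.+1%:R / pi))).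
  under eq_fun do rewrite dE.
  apply: cmeasM => //; apply: cmeasM; first exact: cmeas_cst.
  by apply: cmeasX; exact: cmeas_wtV.
move=> z; rewrite dE !modcM modcX !modc_real.
have p0 : 0 <= (tau.+1%:R / pi : R) by rewrite divr_ge0// pi_ge0.
rewrite (ger0_norm p0) (ger0_norm (_ : 0 <= (wt z)^-1)) ?invr_ge0 ?(ltW (wt_gt0 _))//.
rewrite exprD mulrA mulrA -exprVn.
apply: ler_wpM2r; first by rewrite exprn_ge0// invr_ge0 ltW// wt_gt0.
rewrite mulrAC; apply: ler_wpM2r => //.
apply: (le_trans (ler_wpM2r _ (gM z))).
  by rewrite exprn_ge0// invr_ge0 ltW// wt_gt0.
by rewrite exprM hw_sqr -mulrA -exprMn mulfV ?wt_neq0// expr1n mulr1.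
Qed.

Lemma iintD tau f g : adm (2 * tau) f -> adm (2 * tau) g ->
  iint tau (fun z => f z + g z) = iint tau f + iint tau g.
Proof.
move=> af ag; rewrite /iint -cintD; [|exact: adm_cintegr..].
by congr cint; apply/funext => z; rewrite mulrDl.
Qed.

Lemma iintZ tau (a : C) g : adm (2 * tau) g ->
  iint tau (fun z => a * g z) = a * iint tau g.
Proof.
move=> ag; rewrite /iint -cintZ; last exact: adm_cintegr.
by congr cint; apply/funext => z; rewrite mulrA.
Qed.

Lemma iint0 tau : iint tau (fun=> 0 : C) = 0.
Proof.
have h := @iintZ tau 0 (fun=> 0) (adm_le (leq0n _) (adm_cst 0)).
by rewrite -[RHS](mul0r (iint tau (fun=> 0))) -h mul0r.
Qed.

Lemma iint_sum tau (I : Type) (r : seq I) (F : I -> C -> C) :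
  (forall i, adm (2 * tau) (F i)) ->
  iint tau (fun z => \sum_(i <- r) F i z) = \sum_(i <- r) iint tau (F i).
Proof.
move=> aF; elim: r => [|i r ih].
  rewrite big_nil -[RHS](iint0 tau); congr iint; apply/funext => z.
  by rewrite big_nil.
rewrite big_cons -ih -iintD//; last by apply: adm_sum.
by congr iint; apply/funext => z; rewrite big_cons.
Qed.

Lemma eq_iint tau f g : f =1 g -> iint tau f = iint tau g.
Proof. by move=> /funext ->. Qed.

End Admissible.

(** * Moments of the measures iota_tau *)

Section Moments.
Variable R : realType.
Local Notation C := R[i].
Local Notation mu := (@lebesgue_measure R).

Definition cder (g g' : R -> C) := forall x : R,
  is_derive x 1 (fun t => complex.Re (g t)) (complex.Re (g' x)) /\
  is_derive x 1 (fun t => complex.Im (g t)) (complex.Im (g' x)).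

Lemma cder_cst (a : C) : cder (fun=> a) (fun=> 0).
Proof. by move=> x; split; apply: is_derive_cst. Qed.

Lemma cderD g g' h h' : cder g g' -> cder h h' ->
  cder (fun t => g t + h t) (fun t => g' t + h' t).
Proof.
move=> dg dh x; have [g1 g2] := dg x; have [h1 h2] := dh x; split.
  rewrite raddfD /=; under eq_fun do rewrite raddfD /=.
  exact: (is_deriveD g1 h1).
rewrite raddfD /=; under eq_fun do rewrite raddfD /=.
exact: (is_deriveD g2 h2).
Qed.

Lemma cderM g g' h h' : cder g g' -> cder h h' ->
  cder (fun t => g t * h t) (fun t => g t * h' t + h t * g' t).
Proof.
move=> dg dh x; have [g1 g2] := dg x; have [h1 h2] := dh x; split.
  rewrite raddfD /= !ReM; under eq_fun do rewrite ReM.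
  apply: (is_derive_eq (is_deriveB (is_deriveM g1 h1) (is_deriveM g2 h2))).
  by rewrite /GRing.scale /=; ring.
rewrite raddfD /= !ImM; under eq_fun do rewrite ImM.
apply: (is_derive_eq (is_deriveD (is_deriveM g1 h2) (is_deriveM g2 h1))).
by rewrite /GRing.scale /=; ring.
Qed.

Lemma eq_cder g g' h' : cder g g' -> g' =1 h' -> cder g h'.
Proof. by move=> dg /funext <-. Qed.

Lemma cderZ (a : C) g g' : cder g g' -> cder (fun t => a * g t) (fun t => a * g' t).
Proof.
move=> dg; apply: eq_cder (cderM (cder_cst a) dg) _ => x /=.
by rewrite mulr0 addr0.
Qed.

Lemma cderX n g g' : cder g g' ->
  cder (fun t => g t ^+ n) (fun t => n%:R * g t ^+ n.-1 * g' t).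
Proof.
move=> dg; elim: n => [|n ih].
  by apply: eq_cder (cder_cst 1) _ => x /=; rewrite !mul0r.
under eq_fun do rewrite exprS.
apply: eq_cder (cderM dg ih) _ => x /=.
case: n {ih} => [|n] /=; first by rewrite expr0; ring.
by rewrite !exprS -(natr1 n.+1); ring.
Qed.

Lemma cderJ g g' : cder g g' -> cder (fun t => (g t)^*) (fun t => (g' t)^*).
Proof.
move=> dg x; have [g1 g2] := dg x; split.
  by move: g1; congr (is_derive _ _ _ _); [apply/funext => t; case: (g t)|case: (g' x)].
have := is_deriveN g2.
by congr (is_derive _ _ _ _); [apply/funext => t; rewrite fctE; case: (g t)|case: (g' x)].
Qed.

Lemma cderV (h : R -> R) g' : (forall t, h t != 0) -> cder (fun t => (h t)%:C) g' ->
  cder (fun t => (h t)^-1%:C) (fun t => - ((h t)^-1%:C ^+ 2 * g' t)).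
Proof.
move=> h0 dh x; have [h1 h2] := dh x.
(* The function is real-valued, so the imaginary part of its derivative is the derivative of a
   constant. *)
have gi : complex.Im (g' x) = 0.
  have := @derive_val _ _ _ _ _ _ _ h2.
  have := @derive_val _ _ _ _ _ _ _ (is_derive_cst (0 : R) x 1).
  by move=> <- <-.
have e : - ((h x)^-1%:C ^+ 2 * g' x) = (- (h x) ^- 2 *: complex.Re (g' x))%:C.
  rewrite -rmorphXn /=; case: (g' x) gi => a b /= ->; apply/eqP.
  rewrite eq_complex /= /GRing.scale /=; apply/andP; split; apply/eqP; rewrite ?exprVn; ring.
rewrite e; split; last exact: is_derive_cst.
exact: is_deriveV.
Qed.

Lemma cder_cont g g' : cder g g' ->
  continuous (fun t => complex.Re (g t)) /\ continuous (fun t => complex.Im (g t)).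
Proof.
move=> dg; split.
  by apply: (@is_derive_continuous _ _ (fun x => complex.Re (g' x))) => x; have [] := dg x.
by apply: (@is_derive_continuous _ _ (fun x => complex.Im (g' x))) => x; have [] := dg x.
Qed.

Lemma cder_hline (y : R) : cder (fun x => x +i* y) (fun=> 1).
Proof. by move=> x; split => /=; [exact: is_derive_id|exact: is_derive_cst]. Qed.

Lemma cder_vline (x : R) : cder (fun y => x +i* y) (fun=> 'i%C).
Proof. by move=> y; split => /=; [exact: is_derive_cst|exact: is_derive_id]. Qed.

Definition mono a b N (z : C) : C := z ^+ a * z^* ^+ b * (wt z ^- N)%:C.

(** The derivative of [mono a b N] along a line of velocity d: z changes by d, conj(z) by conj(d),
    and W by z conj(d) + conj(z) d. Where [a.-1] or [b.-1] truncates, its coefficient is 0. *)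
Definition dmono (d : C) a b N (z : C) : C :=
  a%:R * d * mono a.-1 b N z + b%:R * d^* * mono a b.-1 N z
  - N%:R * (d * mono a b.+1 N.+1 z + d^* * mono a.+1 b N.+1 z).

Lemma cder_mono (g : R -> C) d a b N : cder g (fun=> d) ->
  cder (fun t => mono a b N (g t)) (fun t => dmono d a b N (g t)).
Proof.
move=> dg.
have dw : cder (fun t => (wt (g t))%:C) (fun t => g t * d^* + (g t)^* * d).
  under eq_fun do rewrite wtC.
  apply: eq_cder (cderD (cder_cst 1) (cderM dg (cderJ dg))) _ => t /=.
  by rewrite add0r.
have dv := cderV (fun t => wt_neq0 (g t)) dw.
have := cderM (cderM (cderX a dg) (cderX b (cderJ dg))) (cderX N dv).
rewrite /mono /dmono /mono => h.
under eq_fun do rewrite wtVX.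
apply: eq_cder h _ => t /=; rewrite !wtVX.
set v := (_^-1)%:C; move: (v) => {}v; move: (g t) => z; rewrite !exprS.
case: N => [|N]; rewrite /= ?exprS; ring.
Qed.

Lemma modc_mono a b N (z : C) : normc (mono a b N z) <= hw z ^+ (a + b) * wt z ^- N.
Proof.
have w0 : 0 <= wt z ^- N by rewrite invr_ge0 exprn_ge0// ltW// wt_gt0.
rewrite !modcM !modcX modc_real (ger0_norm w0) modcJ -exprD.
by rewrite ler_wpM2r// lerXn2r ?nnegrE ?modc_ge0 ?(ltW (hw_gt0 _)) ?modc_le_hw.
Qed.

Lemma modc_mono_le a b N k (z : C) : (a + b + 2 * k <= 2 * N)%N ->
  normc (mono a b N z) <= wt z ^- k.
Proof.
move=> h; apply: (le_trans (modc_mono _ _ _ _)).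
have w0 n : 0 < wt z ^+ n by rewrite exprn_gt0// wt_gt0.
rewrite ler_pdivrMr// mulrC ler_pdivlMr// -!hw_sqr -!exprM -exprD.
by rewrite ler_weXn2l ?hw_ge1.
Qed.

Lemma modc_nat n : normc (n%:R : C) = n%:R.
Proof.
have -> : (n%:R : C) = (n%:R)%:C by rewrite rmorph_nat.
by rewrite modc_real normr_nat.
Qed.

(** Each term of [dmono] has growth order a + b - 1 - 2 N, one less than [mono]; the hypothesis says
    exactly that this is at most -4, the order of W^-2. *)
Lemma modc_dmono (d : C) a b N z : normc d = 1 -> (a + b + 3 <= 2 * N)%N ->
  normc (dmono d a b N z) <= (a + b + 2 * N)%:R * wt z ^- 2.
Proof.
move=> d1 h.
have w0 : 0 <= wt z ^- 2 by rewrite invr_ge0 exprn_ge0// ltW// wt_gt0.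
have md (x : C) a' b' N' :
  normc (x * mono a' b' N' z) = normc x * normc (mono a' b' N' z) by exact: modcM.
apply: (le_trans (modcD _ _)); rewrite natrD mulrDl; apply: lerD.
  apply: (le_trans (modcD _ _)); rewrite natrD mulrDl; apply: lerD.
    rewrite md modcM modc_nat d1 mulr1.
    case: a h => [|a] h; first by rewrite !mul0r.
    by apply: ler_wpM2l => //; apply: modc_mono_le => /=; lia.
  rewrite md modcM modc_nat modcJ d1 mulr1.
  case: b h => [|b] h; first by rewrite !mul0r.
  by apply: ler_wpM2l => //; apply: modc_mono_le => /=; lia.
rewrite modcN modcM modc_nat natrM [2 * _]mulrC -mulrA; apply: ler_wpM2l => //.
apply: (le_trans (modcD _ _)); rewrite !md modcJ d1 !mul1r mulr_natl mulr2n.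
by apply: lerD; apply: modc_mono_le; lia.
Qed.

Lemma cmeas_mono a b N : cmeas (mono a b N).
Proof.
rewrite /mono; apply: cmeasM.
  by apply: cmeasM; apply: cmeasX; [exact: cmeas_id|exact: (cmeasJ (cmeas_id _))].
by under eq_fun do rewrite wtVX; apply: cmeasX; exact: cmeas_wtV.
Qed.

Lemma cmeas_dmono d a b N : cmeas (dmono d a b N).
Proof.
have m := cmeas_mono.
rewrite /dmono; apply: cmeasD.
  by apply: cmeasD; apply: cmeasM => //; apply: cmeas_cst.
have -> : (fun z => - (N%:R * (d * mono a b.+1 N.+1 z + d^* * mono a.+1 b N.+1 z))) =
  (fun z => - N%:R * (d * mono a b.+1 N.+1 z + d^* * mono a.+1 b N.+1 z)).
  by apply/funext => z; rewrite mulNr.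
apply: cmeasM; first exact: cmeas_cst.
by apply: cmeasD; apply: cmeasM => //; apply: cmeas_cst.
Qed.

Lemma cder_dmono (g : R -> C) d a b N : cder g (fun=> d) ->
  exists g', cder (fun t => dmono d a b N (g t)) g'.
Proof.
move=> dg; have m a' b' N' := cder_mono a' b' N' dg.
eexists; rewrite /dmono; apply: cderD.
  by apply: cderD; apply: cderZ; exact: m.
have -> : (fun t => - (N%:R * (d * mono a b.+1 N.+1 (g t) + d^* * mono a.+1 b N.+1 (g t)))) =
  (fun t => - N%:R * (d * mono a b.+1 N.+1 (g t) + d^* * mono a.+1 b N.+1 (g t))).
  by apply/funext => z; rewrite mulNr.
by apply: cderZ; apply: cderD; apply: cderZ; exact: m.
Qed.

(** W >= 1 + t^2 along the line makes [mono] and its derivative O(1 / (1 + t^2)), so the total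
    derivative integrates to 0. *)
Lemma integral_line_dmono (g : R -> C) d a b N : cder g (fun=> d) -> normc d = 1 ->
  (forall t, 1 + t ^+ 2 <= wt (g t)) -> (a + b + 3 <= 2 * N)%N ->
  (\int[mu]_t (complex.Re (dmono d a b N (g t)))%:E = 0)%E /\
  (\int[mu]_t (complex.Im (dmono d a b N (g t)))%:E = 0)%E.
Proof.
move=> dg d1 gt h.
have [g' /cder_cont[c1 c2]] := cder_dmono a b N dg.
have dm := cder_mono a b N dg.
(* The successor ensures M >= 1, so that M also serves as the constant for [mono] itself. *)
pose M : R := (a + b + 2 * N).+1%:R.
have M1 : 1 <= M by rewrite ler1n.
have wV t : (wt (g t))^-1 <= (1 + t ^+ 2)^-1.
  by rewrite lef_pV2 ?posrE ?wt_gt0 ?oneDsqr_gt0.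
have b1 t : normc (mono a b N (g t)) <= M / (1 + t ^+ 2).
  apply: (@le_trans _ _ (wt (g t))^-1).
    by rewrite -[wt _]expr1; apply: modc_mono_le; lia.
  apply: (le_trans (wV t)).
  by rewrite ler_peMl// invr_ge0 ltW// oneDsqr_gt0.
have b2 t : normc (dmono d a b N (g t)) <= M / (1 + t ^+ 2).
  apply: (le_trans (modc_dmono _ d1 h)).
  apply: ler_pM; rewrite ?invr_ge0 ?sqr_ge0 ?ler_nat//.
  apply: le_trans (wV t).
  by rewrite lef_pV2 ?posrE ?wt_gt0 ?exprn_gt0 ?wt_gt0// expr2 ler_peMl ?wt_ge1 ?ltW ?wt_gt0.
split.
  apply: (@integral_derive_eq0 _ (fun t => complex.Re (mono a b N (g t))) _ M) => //.
  - by move=> x; have [] := dm x.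
  - by move=> x; apply: le_trans (b1 x); exact: Re_le_modc.
  - by move=> x; apply: le_trans (b2 x); exact: Re_le_modc.
apply: (@integral_derive_eq0 _ (fun t => complex.Im (mono a b N (g t))) _ M) => //.
- by move=> x; have [] := dm x.
- by move=> x; apply: le_trans (b1 x); exact: Im_le_modc.
- by move=> x; apply: le_trans (b2 x); exact: Im_le_modc.
Qed.

Lemma modc_i : normc ('i%C : C) = 1.
Proof. by rewrite /normc /nsq /= expr0n /= add0r expr1n sqrtr1. Qed.

Lemma cintegr_dmono d a b N : normc d = 1 -> (a + b + 3 <= 2 * N)%N ->
  cintegr (dmono d a b N).
Proof.
move=> d1 h; apply: (cintegr_dom (M := (a + b + 2 * N)%:R)).
  exact: cmeas_dmono.
by move=> z; exact: modc_dmono.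
Qed.

Lemma cint_dx a b N : (a + b + 3 <= 2 * N)%N -> cint (dmono 1 a b N) = 0.
Proof.
move=> h.
have [i1 i2] := cintegr_dmono (modc1 R) h.
have l y := integral_line_dmono (cder_hline y) (modc1 R) _ h.
have lw (y t : R) : 1 + t ^+ 2 <= wt (t +i* y) by rewrite lerD2l /nsq /= lerDl sqr_ge0.
rewrite /cint /leb2 /Rintegral -(integral21_prod_meas1 i1) -(integral21_prod_meas1 i2).
rewrite /fubini_G /=.
under eq_integral => y _ do rewrite (proj1 (l lw y)).
under [X in _ +i* fine X]eq_integral => y _ do rewrite (proj2 (l lw y)).
by rewrite integral0.
Qed.

Lemma cint_dy a b N : (a + b + 3 <= 2 * N)%N -> cint (dmono 'i%C a b N) = 0.
Proof.
move=> h.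
have [i1 i2] := cintegr_dmono modc_i h.
have l x := integral_line_dmono (cder_vline x) modc_i _ h.
have lw (x t : R) : 1 + t ^+ 2 <= wt (x +i* t) by rewrite lerD2l /nsq /= lerDr sqr_ge0.
rewrite /cint /leb2 /Rintegral -(integral12_prod_meas1 i1) -(integral12_prod_meas1 i2).
rewrite /fubini_F /=.
under eq_integral => x _ do rewrite (proj1 (l lw x)).
under [X in _ +i* fine X]eq_integral => x _ do rewrite (proj2 (l lw x)).
by rewrite integral0.
Qed.

Lemma cintegr_mono a b N : (a + b + 4 <= 2 * N)%N -> cintegr (mono a b N).
Proof.
move=> h; apply: (cintegr_dom (M := 1)); first exact: cmeas_mono.
by move=> z; rewrite mul1r; exact: modc_mono_le.
Qed.

(* dmono 1 + i dmono i is twice the zbar-derivative of mono a b N. *)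
Lemma cint_mono_rec a b N : (a + b + 3 <= 2 * N)%N ->
  N%:R * cint (mono a.+1 b N.+1) = b%:R * cint (mono a b.-1 N).
Proof.
move=> h.
have i1 := cintegr_dmono (modc1 R) h; have i2 := cintegr_dmono modc_i h.
have : cint (fun z => dmono 1 a b N z + 'i%C * dmono 'i%C a b N z) = 0.
  rewrite cintD ?cintZ//; last exact: cintegrZ.
  by rewrite cint_dx// cint_dy// mulr0 addr0.
have -> : (fun z => dmono 1 a b N z + 'i%C * dmono 'i%C a b N z) =
  (fun z => (2 * b%:R) * mono a b.-1 N z + (- (2 * N%:R)) * mono a.+1 b N.+1 z).
  apply/funext => z; rewrite /dmono.
  have e1 : ('i%C : C) * 'i%C = -1 by rewrite -expr2 sqr_i.
  have e2 : Num.conj 'i%C = - 'i%C :> C by apply/eqP; rewrite eq_complex /= oppr0 !eqxx.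
  rewrite e2 conjC1.
  transitivity ((a%:R * mono a.-1 b N z - N%:R * mono a b.+1 N.+1 z) * (1 + 'i%C * 'i%C)
     + (b%:R * mono a b.-1 N z - N%:R * mono a.+1 b N.+1 z) * (1 - 'i%C * 'i%C)).
    by ring.
  by rewrite e1; ring.
have im : cintegr (mono a.+1 b N.+1) by apply: cintegr_mono; lia.
(* For b = 0 the first term is removed before the integral is split: [mono a 0 N] need not be
   integrable under the hypothesis. *)
case: b h i1 i2 im => [|b] h i1 i2 im.
  rewrite mulr0 mul0r; under eq_fun do rewrite mul0r add0r.
  rewrite cintZ// => /eqP; rewrite mulNr oppr_eq0 -mulrA mulf_eq0 pnatr_eq0 /=.
  by move=> /eqP.
have im' : cintegr (mono a b.+1.-1 N) by apply: cintegr_mono => /=; lia.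
rewrite cintD; [|exact: cintegrZ..]; rewrite !cintZ//.
rewrite mulNr => /eqP; rewrite subr_eq0 -!mulrA => /eqP /mulfI -> //.
Qed.

Lemma cintJ (g : C -> C) : cintegr g -> cint (fun z => (g z)^*) = (cint g)^*.
Proof.
move=> [_ g2]; rewrite /cint /leb2; congr (_ +i* _).
  by apply: eq_Rintegral => p _; case: (g _).
rewrite -mulN1r -RintegralZl//; apply: eq_Rintegral => p _.
by rewrite mulN1r; case: (g _).
Qed.

Lemma monoJ a b N (z : C) : (mono a b N z)^* = mono b a N z.
Proof. by rewrite /mono !rmorphM !rmorphXn /= conjCK conj_real [X in X * _]mulrC. Qed.

(** Since W = 1 + z conj(z), the integral for n+2 is the sum of those of [mono 0 0 n.+3] and
    [mono 1 1 n.+3]. The recursion makes the latter 1/(n+2) of the original. *)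
Lemma cint_mono00 n : cint (mono 0 0 n.+2) = (pi / n.+1%:R)%:C :> C.
Proof.
elim: n => [|n ih].
  have -> : mono 0 0 2 = (fun z : C => (wt z ^- 2)%:C).
    by apply/funext => z; rewrite /mono !expr0 !mul1r.
  rewrite divr1 /cint /leb2 /Rintegral; congr (_ +i* _); last by rewrite integral0.
  by rewrite integral_wt2.
have r := @cint_mono_rec 0 1 n.+2 ltac:(lia).
have s : cint (mono 0 0 n.+2) = cint (mono 0 0 n.+3) + cint (mono 1 1 n.+3) :> C.
  rewrite -cintD; [|by apply: cintegr_mono; lia..].
  congr cint; apply/funext => z.
  transitivity ((1 + z * z^*) * (wt z ^- n.+3)%:C); last by rewrite /mono; ring.
  rewrite -wtC /mono !expr0 !mul1r -rmorphM /=; congr (_%:C).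
  have w := wt_neq0 z; rewrite [in RHS](exprS _ n.+2); field.
  by rewrite w expf_neq0.
rewrite ih in s *.
have r' := r; rewrite /= ih mul1r in r'.
have n2 : (n.+2%:R : C) != 0 by rewrite pnatr_eq0.
have n1 : (n.+1%:R : C) != 0 by rewrite pnatr_eq0.
apply: (mulfI n2).
rewrite -[cint (mono 0 0 n.+3)](addrK (cint (mono 1 1 n.+3))) -s mulrBr r'.
rewrite !rmorphM /= !fmorphV /= !rmorph_nat.
move: (pi%:C : C) => q; rewrite -(natr1 n.+1); field.
by rewrite nat1r natr1 n2 n1.
Qed.

(** The recursion lowers a, b and tau together, with factor (b+1)/(t+1) = C(t,b)/C(t+1,b+1). Off the
    diagonal one exponent reaches 0 first, where the recursion, conjugated when a = 0, gives 0. *)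
Lemma moment a b tau : (a <= tau)%N -> (b <= tau)%N ->
  iint tau (fun z => z ^+ a * z^* ^+ b) = if a == b then 'C(tau, a)%:R^-1 else 0 :> C.
Proof.
have toJ a' b' t : (a' <= t)%N -> (b' <= t)%N ->
  iint t (fun z => z ^+ a' * z^* ^+ b') = (t.+1%:R / pi)%:C * cint (mono a' b' t.+2).
  move=> a1 b1; rewrite -cintZ; last by apply: cintegr_mono; lia.
  rewrite /iint; congr cint; apply/funext => z.
  rewrite /mono [RHS]mulrCA; congr (_ * _).
  rewrite -rmorphM /=; congr (_%:C).
  rewrite /iota_dens; have := lt0r_neq0 (pi_gt0 R).
  move: (pi : R) => q q0; rewrite !exprS; field.
  by rewrite ?expf_neq0 ?wt_neq0 ?q0.
have pi0 : (pi : R) != 0 by rewrite lt0r_neq0// pi_gt0.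
move=> at_ bt; rewrite toJ//.
elim: tau a b at_ bt => [|t ih] a b.
  rewrite !leqn0 => /eqP-> /eqP->; rewrite eqxx bin0 cint_mono00.
  by rewrite -rmorphM /= divr1 div1r mulVf// invr1.
case: a => [|a]; case: b => [|b] at_ bt.
- by rewrite eqxx bin0 cint_mono00 -rmorphM /= mulrA divfK// mulfV ?invr1// pnatr_eq0.
- have -> : mono 0 b.+1 t.+3 = (fun z => (mono b.+1 0 t.+3 z)^*).
    by apply/funext => z; rewrite monoJ.
  rewrite cintJ; last by apply: cintegr_mono; lia.
  have /eqP := @cint_mono_rec b 0 t.+2 ltac:(lia).
  rewrite mul0r mulf_eq0 pnatr_eq0 /= => /eqP ->.
  by rewrite conjC0 mulr0.
- have /eqP := @cint_mono_rec a 0 t.+2 ltac:(lia).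
  rewrite mul0r mulf_eq0 pnatr_eq0 /= => /eqP ->.
  by rewrite mulr0.
have r := @cint_mono_rec a b.+1 t.+2 ltac:(lia).
have {ih} := ih a b at_ bt; rewrite eqSS => ih.
have t1 : (t.+1%:R : C) != 0 by rewrite pnatr_eq0.
have -> : (t.+2%:R / pi)%:C * cint (mono a.+1 b.+1 t.+3) =
   (b.+1%:R / t.+1%:R) * ((t.+1%:R / pi)%:C * cint (mono a b t.+2)) :> C.
  rewrite !rmorphM /= !rmorph_nat mulrAC r /=.
  move: (pi^-1%:C) (cint _) (t.+1%:R : C) (b.+1%:R : C) t1 => p J u v u0.
  by field.
rewrite ih; case: eqP => [->|_]; last by rewrite mulr0.
have b1 : (b.+1%:R : C) != 0 by rewrite pnatr_eq0.
have c1 : ('C(t, b)%:R : C) != 0 by rewrite pnatr_eq0 -lt0n bin_gt0.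
have c2 : ('C(t.+1, b.+1)%:R : C) != 0 by rewrite pnatr_eq0 -lt0n bin_gt0.
have e : b.+1%:R * 'C(t.+1, b.+1)%:R = t.+1%:R * 'C(t, b)%:R :> C.
  by rewrite -!natrM mul_bin_diag.
apply: (mulfI c2); rewrite mulfV//; apply: (mulIf c1).
rewrite mul1r -mulrA mulrAC.
apply: (mulfI t1); rewrite -e; move: (b.+1%:R : C) (t.+1%:R : C) ('C(t, b)%:R : C) t1 c1.
by move: ('C(t.+1, b.+1)%:R : C) => q u v w v0 w0; field; rewrite ?v0 ?w0.
Qed.

End Moments.

(** * Pairing of powers of linear forms *)

Section FormPairing.
Variable R : realType.
Local Notation C := R[i].
Implicit Types (P Q : {poly C}).

(** The inner product of H_n in coefficients: monomials are orthogonal and z^i has squared norm 1 /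
    C(n,i). [iint_poly] links it to the integral. *)
Definition ipp n P Q : C := \sum_(i < n.+1) P`_i * (Q`_i)^* / 'C(n, i)%:R.

Lemma bin_neq0 n (i : 'I_n.+1) : ('C(n, i)%:R : C) != 0.
Proof. by rewrite pnatr_eq0 -lt0n bin_gt0 -ltnS. Qed.

Lemma adm_fmono n (f : C -> C) (i j : 'I_n.+1) : adm 0 f ->
  adm (2 * n) (fun z => f z * (z ^+ i * z^* ^+ j)).
Proof.
move=> af; have := admM af (@adm_mono R i j); rewrite add0n.
apply: adm_le; have := ltn_ord i; have := ltn_ord j; lia.
Qed.

Lemma iint_fpoly n (f : C -> C) P Q : adm 0 f ->
  (size P <= n.+1)%N -> (size Q <= n.+1)%N ->
  iint n (fun z => f z * (P.[z] * (Q.[z])^*)) =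
  \sum_(i < n.+1) \sum_(j < n.+1)
     P`_i * (Q`_j)^* * iint n (fun z => f z * (z ^+ i * z^* ^+ j)).
Proof.
move=> af sP sQ.
rewrite (@eq_iint _ n _ (fun z => \sum_(i < n.+1) \sum_(j < n.+1)
     (P`_i * (Q`_j)^*) * (f z * (z ^+ i * z^* ^+ j)))); last first.
  move=> z; rewrite (horner_coef_wide _ sP) (horner_coef_wide _ sQ).
  rewrite rmorph_sum big_distrlr mulr_sumr; apply: eq_bigr => i _.
  rewrite mulr_sumr; apply: eq_bigr => j _.
  by rewrite rmorphM rmorphXn /=; ring.
rewrite iint_sum => [|i]; last by apply: adm_sum => j _; apply: admZ; exact: adm_fmono.
apply: eq_bigr => i _; rewrite iint_sum => [|j]; last by apply: admZ; exact: adm_fmono.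
by apply: eq_bigr => j _; rewrite iintZ//; exact: adm_fmono.
Qed.

Lemma iint_poly n P Q : (size P <= n.+1)%N -> (size Q <= n.+1)%N ->
  iint n (fun z => P.[z] * (Q.[z])^*) = ipp n P Q.
Proof.
move=> sP sQ; have := iint_fpoly (adm_cst 1) sP sQ.
under eq_fun do rewrite mul1r.
move=> ->; apply: eq_bigr => i _.
rewrite (bigD1 i)//= big1 ?addr0 => [|j ji].
  under eq_fun do rewrite mul1r.
  by rewrite moment ?eqxx// -ltnS.
under eq_fun do rewrite mul1r.
rewrite moment; [|by rewrite -ltnS..].
by rewrite (inj_eq val_inj) eq_sym (negbTE ji) mulr0.
Qed.

Definition lin (a : C * C) : {poly C} := a.1%:P + a.2 *: 'X.
Definition fpair (a b : C * C) : C := a.1 * b.1^* + a.2 * b.2^*.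

Lemma linX (a : C * C) n :
  lin a ^+ n = \poly_(i < n.+1) ('C(n, i)%:R * a.1 ^+ (n - i) * a.2 ^+ i).
Proof.
rewrite poly_def exprDn; apply: eq_bigr => i _.
rewrite exprZn -rmorphXn /= -mul_polyC -!mul_polyC !polyCM.
by rewrite polyC_natr -mulr_natl !mulrA rmorphXn /= -?rmorphXn.
Qed.

Lemma coef_linX (a : C * C) n i :
  (lin a ^+ n)`_i = 'C(n, i)%:R * a.1 ^+ (n - i) * a.2 ^+ i.
Proof.
rewrite linX coef_poly ltnS; case: leqP => // ni.
by rewrite bin_small// !mul0r.
Qed.

Lemma size_linX (a : C * C) n : (size (lin a ^+ n)%R <= n.+1)%N.
Proof. by rewrite linX size_poly. Qed.

Lemma size_linXM (a b : C * C) p q : (size (lin a ^+ p * lin b ^+ q)%R <= (p + q).+1)%N.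
Proof.
apply: (leq_trans (size_polyMleq _ _)).
have := size_linX a p; have := size_linX b q; lia.
Qed.

Lemma ippDr n P Q1 Q2 : ipp n P (Q1 + Q2) = ipp n P Q1 + ipp n P Q2.
Proof.
by rewrite -big_split /=; apply: eq_bigr => i _; rewrite coefD rmorphD mulrDr mulrDl.
Qed.

Lemma ippZr n P (a : C) Q : ipp n P (a *: Q) = a^* * ipp n P Q.
Proof. by rewrite mulr_sumr; apply: eq_bigr => i _; rewrite coefZ rmorphM; ring. Qed.

Lemma ipp0r n P : ipp n P 0 = 0.
Proof. by rewrite -(scale0r 0) ippZr conjC0 mul0r. Qed.

Lemma ipp_sumr n P (I : Type) (r : seq I) (F : I -> {poly C}) :
  ipp n P (\sum_(i <- r) F i) = \sum_(i <- r) ipp n P (F i).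
Proof. by elim/big_rec2: _ => [|i y x _ <-]; rewrite ?ipp0r ?ippDr. Qed.

(** The binomial coefficients of c^n cancel the weights of the pairing, which thus evaluates the
    left factor, as a homogeneous form, at conj(c); evaluation is multiplicative. *)
Lemma ipp_linX p q (a b c : C * C) :
  ipp (p + q) (lin a ^+ p * lin b ^+ q) (lin c ^+ (p + q)) = fpair a c ^+ p * fpair b c ^+ q.
Proof.
have -> : ipp (p + q) (lin a ^+ p * lin b ^+ q) (lin c ^+ (p + q)) =
   \sum_(i < (p + q).+1) (lin a ^+ p * lin b ^+ q)`_i
      * (c.1^* ^+ (p + q - i) * c.2^* ^+ i).
  apply: eq_bigr => i _; rewrite coef_linX !rmorphM !rmorphXn /= conjC_nat.
  by have := bin_neq0 i; move: ('C(_, _)%:R) => B B0; field.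
rewrite ![fpair _ _ ^+ _]exprDn big_distrlr /=.
have -> : lin a ^+ p * lin b ^+ q = \sum_(r < p.+1) \sum_(s < q.+1)
   ('C(p, r)%:R * a.1 ^+ (p - r) * a.2 ^+ r * ('C(q, s)%:R * b.1 ^+ (q - s) * b.2 ^+ s))
   *: 'X^(r + s).
  rewrite !linX !poly_def big_distrlr /=; apply: eq_bigr => r _; apply: eq_bigr => s _.
  by rewrite -scalerAl -scalerAr scalerA exprD.
under eq_bigr => i _ do rewrite coef_sum mulr_suml.
rewrite exchange_big; apply: eq_bigr => r _ /=.
under eq_bigr => i _ do rewrite coef_sum mulr_suml.
rewrite exchange_big; apply: eq_bigr => s _ /=.
have rs : (r + s < (p + q).+1)%N by have := ltn_ord r; have := ltn_ord s; lia.
rewrite (bigD1 (Ordinal rs))//= big1 ?addr0 => [|i].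
  rewrite coefZ coefXn eqxx mulr1.
  have -> : (p + q - (r + s) = (p - r) + (q - s))%N.
    by have := ltn_ord r; have := ltn_ord s; lia.
  by rewrite !exprMn !exprD -[_ *+ 'C(p, r)]mulr_natl -[_ *+ 'C(q, s)]mulr_natl; ring.
rewrite -(inj_eq val_inj) /= => h.
by rewrite coefZ coefXn (negbTE h) mulr0 mul0r.
Qed.

(** Infinitely many test points suffice, and natural ones are real: the parameter t of a pencil c +
    t d then passes unchanged through the antilinear side of the pairing. *)
Lemma poly_eq_nat P Q : (forall n : nat, P.[n%:R] = Q.[n%:R]) -> P = Q.
Proof.
move=> h; apply/eqP; rewrite -subr_eq0; apply/negP => /negP nz.
have := max_poly_roots (rs := [seq n%:R | n <- iota 0 (size (P - Q))]) nz.
rewrite size_map size_iota ltnn => H; have : false; last by [].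
apply: H; first by apply/allP => x /mapP[n _ ->]; rewrite rootE hornerD hornerN h subrr.
rewrite map_inj_uniq ?iota_uniq// => m n /eqP.
by rewrite eqr_nat => /eqP.
Qed.

(* Compare the coefficients of t^q in <a^p b^q, (c + t d)^(p+q)>. *)
Lemma ipp_lin2 p q (a b c d : C * C) :
  'C(p + q, q)%:R * ipp (p + q) (lin a ^+ p * lin b ^+ q) (lin c ^+ p * lin d ^+ q) =
  \sum_(j < q.+1) 'C(p, j)%:R * 'C(q, j)%:R *
     (fpair a c ^+ (p - j) * fpair a d ^+ j * (fpair b d ^+ (q - j) * fpair b c ^+ j)).
Proof.
set n := (p + q)%N; set P := lin a ^+ p * lin b ^+ q.
(* [L] and [Q] are the two sides of the reproducing formula as polynomials in t. *)
pose L := \poly_(i < n.+1) ('C(n, i)%:R * ipp n P (lin c ^+ (n - i) * lin d ^+ i)).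
pose Q := lin (fpair a c, fpair a d) ^+ p * lin (fpair b c, fpair b d) ^+ q.
have LQ : L = Q.
  apply: poly_eq_nat => m; pose t : C := m%:R.
  have tJ : t^* = t by rewrite conjC_nat.
  pose e := (c.1 + t * d.1, c.2 + t * d.2).
  have lE : lin e = lin c + t *: lin d.
    by rewrite /lin /e /= !(polyCD, polyCM, scalerDl, scalerDr) -!mul_polyC !polyCM; ring.
  transitivity (ipp n P (lin e ^+ n)); last first.
    rewrite ipp_linX /Q hornerM !horner_exp.
    by congr (_ ^+ _ * _ ^+ _); rewrite /lin !hornerE /fpair /= !rmorphD !rmorphM /= tJ /t; ring.
  rewrite lE exprDn ipp_sumr horner_poly; apply: eq_bigr => i _.
  rewrite exprZn -scalerAr -[X in _ = ipp n P X]scaler_nat scalerA ippZr rmorphM /= rmorphXn /= tJ conjC_nat.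
  by rewrite /t; ring.
have /(congr1 (fun r : {poly C} => r`_q)) := LQ.
rewrite coef_poly ltnS leq_addl /n addnK => ->.
rewrite coefM; apply: eq_bigr => j _; rewrite !coef_linX /=.
have jq : (j <= q)%N by rewrite -ltnS.
by rewrite bin_sub// subKn//; ring.
Qed.

End FormPairing.

(** * The space Im(R_n) in coordinates *)

Section SymbolSpace.
Variable R : realType.
Local Notation C := R[i].
Implicit Types (f g : C -> C).

(* Coordinates for Im(R_n); see ImR_inV. *)
Definition inV n f := exists c : 'I_n.+1 -> 'I_n.+1 -> C,
  f = fun z => \sum_(i < n.+1) \sum_(j < n.+1) c i j * mono i j n z.

Lemma inVD n f g : inV n f -> inV n g -> inV n (fun z => f z + g z).
Proof.
move=> [c ->] [d ->]; exists (fun i j => c i j + d i j); apply/funext => z.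
rewrite -big_split; apply: eq_bigr => i _ /=.
by rewrite -big_split; apply: eq_bigr => j _ /=; rewrite mulrDl.
Qed.

Lemma inVZ n (a : C) f : inV n f -> inV n (fun z => a * f z).
Proof.
move=> [c ->]; exists (fun i j => a * c i j); apply/funext => z.
rewrite mulr_sumr; apply: eq_bigr => i _.
by rewrite mulr_sumr; apply: eq_bigr => j _; rewrite mulrA.
Qed.

Lemma inV0 n : inV n (fun=> 0).
Proof.
by exists (fun _ _ => 0); apply/funext => z; rewrite big1// => i _; rewrite big1// => j _; rewrite mul0r.
Qed.

Lemma inV_sum n (I : Type) (r : seq I) (F : I -> C -> C) :
  (forall i, inV n (F i)) -> inV n (fun z => \sum_(i <- r) F i z).
Proof.
move=> VF; elim: r => [|i r ih]; first by under eq_fun do rewrite big_nil; exact: inV0.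
by under eq_fun do rewrite big_cons; exact: inVD.
Qed.

Lemma inV_mono n i j : (i <= n)%N -> (j <= n)%N -> inV n (mono i j n).
Proof.
rewrite -ltnS => lei; rewrite -ltnS => lej.
exists (fun i' j' => if (i' == Ordinal lei) && (j' == Ordinal lej) then 1 else 0).
apply/funext => z; rewrite (bigD1 (Ordinal lei))//= [X in _ + X]big1 => [|i' /negbTE ne].
  rewrite (bigD1 (Ordinal lej))//= big1 => [|j' /negbTE ne]; last by rewrite ne andbF mul0r.
  by rewrite !eqxx mul1r !addr0.
by apply: big1 => j' _; rewrite ne mul0r.
Qed.

Lemma monoM a b m c d n (z : C) :
  mono a b m z * mono c d n z = mono (a + c) (b + d) (m + n) z.
Proof. by rewrite /mono !exprD invfM rmorphM /=; ring. Qed.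

Lemma inVM m n f g : inV m f -> inV n g -> inV (m + n) (fun z => f z * g z).
Proof.
move=> [c ->] [d ->].
under eq_fun do rewrite mulr_suml; apply: inV_sum => i.
under eq_fun do rewrite mulr_suml; apply: inV_sum => j.
under eq_fun do rewrite mulr_sumr; apply: inV_sum => k.
under eq_fun do rewrite mulr_sumr; apply: inV_sum => l.
have -> : (fun z : C => c i j * mono i j m z * (d k l * mono k l n z)) =
  (fun z => c i j * d k l * mono (i + k) (j + l) (m + n) z).
  by apply/funext => z; rewrite -monoM; ring.
apply: inVZ; apply: inV_mono.
  by have := ltn_ord i; have := ltn_ord k; lia.
by have := ltn_ord j; have := ltn_ord l; lia.
Qed.

(** 1 = (1 + z conj(z)) / W; multiplying by this expression raises n and yields the inclusions of
    [inV_le]. *)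
Lemma inV1 : inV 1 (fun=> 1).
Proof.
have -> : (fun=> 1) = (fun z : C => mono 0 0 1 z + mono 1 1 1 z).
  apply/funext => z; transitivity ((1 + z * z^*) * (wt z ^- 1)%:C); last by rewrite /mono; ring.
  by rewrite -wtC -rmorphM /= mulfV ?wt_neq0.
by apply: inVD; apply: inV_mono.
Qed.

Lemma inV_le m n f : (m <= n)%N -> inV m f -> inV n f.
Proof.
move=> /subnK <- Vf; elim: (n - m)%N => [//|k ih].
have := inVM inV1 ih; rewrite add1n addSn.
by under eq_fun do rewrite mul1r.
Qed.

Lemma inVX n f k : inV n f -> inV (k * n) (fun z => f z ^+ k).
Proof.
move=> Vf; elim: k => [|k ih].
  have -> : (fun z => f z ^+ 0) = mono 0 0 0.
    by apply/funext => z; rewrite /mono !expr0 invr1 !mul1r.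
  exact: inV_mono.
by under eq_fun do rewrite exprS; rewrite mulSn; exact: inVM.
Qed.

Lemma adm_inV n f : inV n f -> adm 0 f.
Proof.
move=> [c ->]; apply: adm_sum => i _; apply: adm_sum => j _; apply: admZ.
split; first exact: cmeas_mono.
exists 1 => z; rewrite mulr1; apply: (le_trans (modc_mono_le (k := 0) _ _)).
  by have := ltn_ord i; have := ltn_ord j; lia.
by rewrite expr0 invr1.
Qed.

Lemma isOp0 n G : isOp n G -> G (fun=> 0 : C) = (fun=> 0).
Proof.
move=> [_ Gl]; have i0 : inH n (fun=> 0 : C).
  by exists 0; rewrite size_poly0; split=> //; apply/funext => x; rewrite horner0.
have := Gl 1 _ _ i0 i0.
have -> : (fun x : C => 1 * 0 + 0) = (fun=> 0 : C) by apply/funext => x; rewrite mulr0 addr0.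
move=> h; apply/funext => x; have := congr1 (fun k => k x) h => /= e.
by apply: (addrI (G (fun=> 0) x)); rewrite addr0 -{1}(mul1r (G _ x)) -e.
Qed.

Lemma inH_Xn n i : (i <= n)%N -> inH n (fun s : C => s ^+ i).
Proof.
move=> lei; exists 'X^i; rewrite size_polyXn ltnS lei; split=> //.
by apply/funext => x; rewrite hornerXn.
Qed.

Lemma isOp_sum n G (a : nat -> C) k : isOp n G -> (k <= n.+1)%N ->
  G (fun s => \sum_(j < k) a j * s ^+ j) =
  (fun x => \sum_(j < k) a j * G (fun s => s ^+ j) x).
Proof.
move=> oG; elim: k => [|k ih] kn.
  under eq_fun do rewrite big_ord0.
  by rewrite (isOp0 oG); apply/funext => x; rewrite big_ord0.
have e (b : nat -> C) : \sum_(j < k.+1) b j = b k + \sum_(j < k) b j.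
  by rewrite big_ord_recr addrC.
under eq_fun do rewrite (e (fun j => a j * _ ^+ j)).
rewrite (proj2 oG); last 2 first.
- exact: inH_Xn.
- exists (\poly_(j < k) a j); split; first by rewrite (leq_trans (size_poly _ _))// ltnW.
  by apply/funext => x; rewrite horner_poly.
rewrite ih ?(ltnW kn)//; apply/funext => x.
by rewrite (e (fun j => a j * G (fun s => s ^+ j) x)).
Qed.

Lemma KernE n (s y : C) : Kern n s y = (lin (1, y^*) ^+ n).[s].
Proof. by rewrite /Kern horner_exp /lin /= !hornerE mulrC. Qed.

Lemma Kern_sum n (y s : C) : Kern n s y = \sum_(j < n.+1) ('C(n, j)%:R * y^* ^+ j) * s ^+ j.
Proof.
rewrite KernE linX horner_poly; apply: eq_bigr => j _ /=.
by rewrite expr1n mulr1.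
Qed.

(** Kernels of operators on H_n are exactly the polynomials of degree <= n in x and in conj(y); on
    the diagonal, divided by W^n, these are the combinations of the [mono i j n]. *)
Lemma ImR_inV n f : ImR n f <-> inV n f.
Proof.
split=> [[G [oG ->]]|[c ->]].
  have -> : Rop n G = (fun z => \sum_(j < n.+1)
      'C(n, j)%:R * (z^* ^+ j * G (fun s => s ^+ j) z * (wt z ^- n)%:C)).
    apply/funext => z; rewrite /Rop /kernelOf.
    under [X in G X]eq_fun do rewrite Kern_sum.
    rewrite (isOp_sum (fun j => 'C(n, j)%:R * z^* ^+ j) oG)// mulr_suml.
    by apply: eq_bigr => j _; rewrite fmorphV; ring.
  apply: inV_sum => j; apply: inVZ.
  have jn : (j <= n)%N by rewrite -ltnS.
  have [p [sp ->]] := proj1 oG _ (inH_Xn jn).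
  have -> : (fun z : C => z^* ^+ j * p.[z] * (wt z ^- n)%:C) =
     (fun z => \sum_(i < n.+1) p`_i * mono i j n z).
    apply/funext => z; rewrite (horner_coef_wide _ sp) mulr_sumr mulr_suml.
    by apply: eq_bigr => i _; rewrite /mono; ring.
  by apply: inV_sum => i; apply: inVZ; apply: inV_mono; rewrite -ltnS.
(* The integral operator with kernel sum c_ij x^i conj(s)^j; on K(., z) the integral reproduces
   conj(z)^j. *)
pose G (h : C -> C) (x : C) :=
  \sum_(i < n.+1) \sum_(j < n.+1) c i j * x ^+ i * iint n (fun s => h s * s^* ^+ j).
exists G; split; last first.
  apply/funext => z; rewrite /Rop /kernelOf /G mulr_suml; apply: eq_bigr => i _.
  rewrite mulr_suml; apply: eq_bigr => j _.
  have -> : iint n (fun s => Kern n s z * s^* ^+ j) = z^* ^+ j.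
    rewrite (@eq_iint _ _ _ (fun s => (lin (1, z^*) ^+ n).[s] * ('X^j).[s]^*)); last first.
      by move=> s; rewrite KernE hornerXn rmorphXn.
    rewrite iint_poly ?size_linX ?size_polyXn// /ipp.
    rewrite (bigD1 j)//= big1 ?addr0 => [|i']; last first.
      rewrite -(inj_eq val_inj) => /negbTE ne.
      by rewrite coefXn ne conjC0 mulr0 mul0r.
    rewrite coefXn eqxx conjC1 mulr1 coef_linX /= expr1n mulr1.
    by rewrite mulrAC mulfV ?mul1r// bin_neq0.
  by rewrite /mono fmorphV; ring.
split=> [h Hh|a h1 h2 Hh1 Hh2].
  exists (\poly_(i < n.+1) \sum_(j < n.+1) c (inord i) j * iint n (fun s => h s * s^* ^+ j)).
  split; first exact: size_poly.
  apply/funext => x; rewrite horner_poly; apply: eq_bigr => i _.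
  by rewrite mulr_suml; apply: eq_bigr => j _; rewrite inord_val; ring.
have aH (h : C -> C) : inH n h -> forall j : 'I_n.+1, adm (2 * n) (fun s => h s * s^* ^+ j).
  move=> [p [sp ->]] j; have := admM (adm_poly sp) (admX j (admJ (adm_id R))).
  by apply: adm_le; have := ltn_ord j; lia.
apply/funext => x; rewrite /G mulr_sumr -big_split; apply: eq_bigr => i _ /=.
rewrite mulr_sumr -big_split; apply: eq_bigr => j _ /=.
rewrite (@eq_iint _ _ _ (fun s => a * (h1 s * s^* ^+ j) + h2 s * s^* ^+ j)); last first.
  by move=> s; rewrite mulrDl mulrA.
rewrite iintD; [|by apply: admZ; exact: aH|exact: aH].
by rewrite iintZ ?mulrDr; [ring|exact: aH].
Qed.

End SymbolSpace.

(** * The Berezin transform on Im(R_mu) *)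

Section Berezin.
Variable R : realType.
Local Notation C := R[i].
Implicit Types (f g : C -> C).

Lemma iota_densE tau (s : C) :
  iota_dens tau s = tau.+1%:R * wt s ^- tau * iota_dens 0 s.
Proof.
rewrite /iota_dens; have := lt0r_neq0 (pi_gt0 R); move: (pi : R) => q q0.
have w := wt_neq0 s; field.
by rewrite ?w ?q0 ?expf_neq0.
Qed.

Lemma iota_densC tau (s : C) :
  (iota_dens tau s)%:C = tau.+1%:R * (wt s ^- tau)%:C * (iota_dens 0 s)%:C.
Proof. by rewrite iota_densE !rmorphM /= rmorph_nat. Qed.

Definition coh tau (z : C) : {poly C} := lin (1, z^*) ^+ tau.

Lemma cohE tau (z s : C) : (coh tau z).[s] = (1 + z^* * s) ^+ tau.
Proof. by rewrite /coh horner_exp /lin /= !hornerE. Qed.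

Lemma cohJ tau (z s : C) : (coh tau z).[s]^* = (1 + z * s^*) ^+ tau.
Proof. by rewrite cohE rmorphXn rmorphD rmorphM rmorph1 /= conjCK. Qed.

Lemma realCV (x : R) : (x^-1)%:C = x%:C^-1.
Proof. exact: fmorphV. Qed.

Lemma realCM (x y : R) : (x * y)%:C = x%:C * y%:C.
Proof. exact: rmorphM. Qed.

Lemma adm_coh2 tau f (z : C) : adm 0 f ->
  adm (2 * tau) (fun s => f s * ((coh tau z).[s] * (coh tau z).[s]^*)).
Proof.
move=> af; have ac := adm_poly (size_linX (1, z^*) tau).
by have := admM af (admM ac (admJ ac)); rewrite add0n mul2n addnn.
Qed.

(** Moving W(s)^-tau into the measure leaves |K^tau(s,z)|^2, so that apart from f the integrand is
    polynomial in s and conj(s). *)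
Lemma Ber_iint tau f (z : C) : adm 0 f ->
  Ber tau f z = (wt z ^- tau)%:C / tau.+1%:R *
    iint tau (fun s => f s * ((coh tau z).[s] * (coh tau z).[s]^*)).
Proof.
move=> af; rewrite -iintZ; last exact: adm_coh2.
rewrite /Ber /iint; congr cint; apply/funext => s.
rewrite (iota_densC tau) cohJ cohE exprMn realCM !realCV.
have t0 : (tau.+1%:R : C) != 0 by rewrite pnatr_eq0.
have w0 (w : C) : (wt w ^+ tau)%:C != 0.
  by rewrite (inj_eq (@complexI R)) expf_neq0// wt_neq0.
move: (tau.+1%:R : C) t0 (w0 z) (w0 s) => t t0 wz ws; field.
by rewrite t0 wz ws.
Qed.

Lemma BerD tau f g (z : C) : adm 0 f -> adm 0 g ->
  Ber tau (fun s => f s + g s) z = Ber tau f z + Ber tau g z.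
Proof.
move=> af ag; rewrite !Ber_iint//; last exact: admD.
rewrite -mulrDr -iintD; [|exact: adm_coh2..]; congr (_ * _).
by apply: eq_iint => s; rewrite mulrDl.
Qed.

Lemma BerZ tau (a : C) f (z : C) : adm 0 f ->
  Ber tau (fun s => a * f s) z = a * Ber tau f z.
Proof.
move=> af; rewrite !Ber_iint//; last exact: admZ.
rewrite [RHS]mulrCA -(iintZ a); last exact: adm_coh2.
by congr (_ * _); apply: eq_iint => s; rewrite mulrA.
Qed.

(** z enters only through |K^tau(s,z)|^2 / W(z)^tau; expanding it leaves finitely many moments of f
    as coefficients. *)
Lemma Ber_inV tau n f : (tau <= n)%N -> adm 0 f -> inV n (Ber tau f).
Proof.
move=> tn af; apply: (inV_le tn).
have -> : Ber tau f = (fun z => \sum_(i < tau.+1) \sum_(j < tau.+1)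
   ('C(tau, i)%:R * 'C(tau, j)%:R / tau.+1%:R *
    iint tau (fun s => f s * (s ^+ i * s^* ^+ j))) * mono j i tau z).
  apply/funext => z; rewrite Ber_iint// iint_fpoly ?size_linX//.
  rewrite mulr_sumr; apply: eq_bigr => i _; rewrite mulr_sumr; apply: eq_bigr => j _.
  rewrite !coef_linX /= !expr1n !mulr1 rmorphM rmorphXn /= conjCK conjC_nat /mono.
  by ring.
apply: inV_sum => i; apply: inV_sum => j; apply: inVZ.
by apply: inV_mono; rewrite -ltnS.
Qed.

(** Polarization of rho: for v = u this is W(u) rho(z,u). Keeping u and v apart lets the powers of z
    and of conj(z) be spanned independently. *)
Definition sig (u v z : C) : C := (1 + z * u^*) * (1 + z^* * v) * ((wt z)^-1)%:C.

Lemma inV_sigX u v l n : (l <= n)%N -> inV n (fun z => sig u v z ^+ l).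
Proof.
move=> ln; apply: (inV_le ln); have : inV 1 (sig u v).
  have -> : sig u v = (fun z => (mono 0 0 1 z + u^* * mono 1 0 1 z) +
      (v * mono 0 1 1 z + u^* * v * mono 1 1 1 z)).
    by apply/funext => z; rewrite /sig /mono /=; ring.
  apply: inVD; apply: inVD; first exact: inV_mono.
  - by apply: inVZ; exact: inV_mono.
  - by apply: inVZ; exact: inV_mono.
  - by apply: inVZ; exact: inV_mono.
by move/(inVX l); rewrite muln1.
Qed.

(* alpha mu nu l -> 1 for l = mu and -> 0 for l < mu as nu -> oo. *)
Definition alpha mu nu l : C :=
  nu.+1%:R / (nu + mu).+1%:R * ('C(nu, l)%:R / 'C(nu + mu, mu)%:R).

(** Against iota_{nu+mu} the integral is <a^nu b^mu, a^nu d^mu> with a = (1, conj z), b = (1, conj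
    u), d = (1, conj v). In the identity for linear forms <a,a> = W(z) cancels the prefactor up to
    W(z)^-l, which joins <a,d>^l <b,a>^l to form sigma^l. *)
Lemma Ber_sigX mu nu (u v z : C) :
  nu.+1%:R * Ber nu (fun s => sig u v s ^+ mu) z =
  \sum_(l < mu.+1) alpha mu nu l *
     ('C(mu, l)%:R * (1 + u^* * v) ^+ (mu - l) * sig u v z ^+ l).
Proof.
have e : Ber nu (fun s => sig u v s ^+ mu) z = (wt z ^- nu)%:C / (nu + mu).+1%:R *
   ipp (nu + mu) (lin (1, z^*) ^+ nu * lin (1, u^*) ^+ mu)
                 (lin (1, z^*) ^+ nu * lin (1, v^*) ^+ mu).
  rewrite -iint_poly ?size_linXM// -iintZ; last first.
    have ac w := adm_poly (size_linXM (1, z^*) (1, w) nu mu).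
    by have := admM (ac u^*) (admJ (ac v^*)); rewrite mul2n addnn.
  rewrite /Ber /iint; congr cint; apply/funext => s.
  have h1 w : (lin (1, z^*) ^+ nu * lin (1, w^*) ^+ mu).[s] =
      (1 + z^* * s) ^+ nu * (1 + w^* * s) ^+ mu by rewrite hornerM -!cohE.
  have h2 w : (lin (1, z^*) ^+ nu * lin (1, w^*) ^+ mu).[s]^* =
      (1 + z * s^*) ^+ nu * (1 + w * s^*) ^+ mu by rewrite hornerM rmorphM -!cohJ.
  rewrite (iota_densC (nu + mu)) h1 h2; move: (iota_dens 0 s)%:C => D.
  rewrite /sig !exprMn -wtVX exprD !(realCM, realCV).
  have t0 : ((nu + mu).+1%:R : C) != 0 by rewrite pnatr_eq0.
  have w0 (w : C) k : (wt w ^+ k)%:C != 0.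
    by rewrite (inj_eq (@complexI R)) expf_neq0// wt_neq0.
  move: ((nu + mu).+1%:R : C) t0 (w0 z nu) (w0 s nu) (w0 s mu) => t t0 wz ws ws'.
  rewrite [s * u^*]mulrC [s^* * v]mulrC; field.
  by rewrite t0 wz ws ws'.
rewrite e; have := ipp_lin2 nu mu (1, z^*) (1, u^*) (1, z^*) (1, v^*).
set I := ipp _ _ _ => h.
have c0 : ('C(nu + mu, mu)%:R : C) != 0 by rewrite pnatr_eq0 -lt0n bin_gt0 leq_addl.
have -> : I = ('C(nu + mu, mu)%:R)^-1 * ('C(nu + mu, mu)%:R * I) by rewrite mulKf.
rewrite h !mulr_sumr; apply: eq_bigr => l _; rewrite /alpha /fpair /= !conjCK !conjC1 !mulr1.
have [ln|nl] := leqP l nu; last by rewrite (bin_small nl) !(mul0r, mulr0).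
have -> : (1 + z^* * z) = (wt z)%:C by rewrite wtC mulrC.
have -> : (wt z ^- nu)%:C = (wt z ^- l)%:C * (wt z)%:C ^- (nu - l).
  by rewrite -{1}(subnKC ln) exprD invfM rmorphM /= [in X in _ * X]fmorphV rmorphXn.
have w0 : (wt z)%:C ^+ (nu - l) != 0 by rewrite expf_neq0// wtC_neq0.
have t0 : ((nu + mu).+1%:R : C) != 0 by rewrite pnatr_eq0.
rewrite /sig !exprMn -wtVX [z * u^*]mulrC.
move: ((nu + mu).+1%:R : C) t0 => t t0.
move: ('C(nu + mu, mu)%:R : C) c0 => c c0.
move: ((wt z)%:C ^+ (nu - l)) w0 => w w0.
by move: ((wt z ^- l)%:C) => x; field; rewrite ?t0 ?c0 ?w0.
Qed.

(** The coefficient of z^p in (1 + i z)^mu is C(mu,p) i^p, and the Vandermonde matrix of the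
    distinct nodes 0, ..., mu is invertible. *)
Lemma power_span mu : exists lam : 'I_mu.+1 -> 'I_mu.+1 -> C,
  forall (a : 'I_mu.+1) (z : C), z ^+ a = \sum_(i < mu.+1) lam a i * (1 + z * i%:R) ^+ mu.
Proof.
pose r : 'rV[C]_mu.+1 := \row_i i%:R.
pose V := Vandermonde mu.+1 r.
have Vu : V \in unitmx.
  rewrite unitmxE det_Vandermonde unitfE; apply/prodf_neq0 => i _.
  apply/prodf_neq0 => j ij; rewrite !mxE subr_eq0 eqr_nat.
  by rewrite gtn_eqF.
exists (fun a i => invmx V i a / 'C(mu, a)%:R) => a z.
transitivity (\sum_(i < mu.+1) \sum_(p < mu.+1)
   invmx V i a / 'C(mu, a)%:R * ('C(mu, p)%:R * z ^+ p * V p i)); last first.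
  apply: eq_bigr => i _; rewrite exprDn mulr_sumr; apply: eq_bigr => p _.
  by rewrite !mxE expr1n mul1r exprMn -mulr_natl; ring.
rewrite exchange_big (bigD1 a)//= [X in _ + X]big1 ?addr0 => [|p pa].
  have := congr1 (fun M : 'M[C]_(mu.+1) => M a a) (mulmxV Vu).
  rewrite !mxE eqxx => h.
  transitivity (z ^+ a * \sum_j V a j * invmx V j a).
    by rewrite h mulr1.
  rewrite mulr_sumr; apply: eq_bigr => i _.
  by have := bin_neq0 R a; move: ('C(mu, a)%:R : C) => c c0; field.
have := congr1 (fun M : 'M[C]_(mu.+1) => M p a) (mulmxV Vu).
rewrite !mxE (negbTE pa) => h.
transitivity ('C(mu, p)%:R / 'C(mu, a)%:R * z ^+ p * \sum_j V p j * invmx V j a).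
  rewrite mulr_sumr; apply: eq_bigr => i _; ring.
by rewrite h mulr0.
Qed.

(** The shape of [Ber_sigX], with functions [psi l] independent of nu and top term f. It is closed
    under linear combinations, so it passes from the powers of [sig] to all of Im(R_mu). *)
Definition expandable mu f := inV mu f /\
  exists psi : 'I_mu.+1 -> C -> C, [/\ forall l, inV mu (psi l), psi ord_max = f &
    forall nu z, nu.+1%:R * Ber nu f z = \sum_(l < mu.+1) alpha mu nu l * psi l z].

Lemma expandableD mu f g : expandable mu f -> expandable mu g ->
  expandable mu (fun z => f z + g z).
Proof.
move=> [Vf [p [Vp pf ep]]] [Vg [q [Vq qg eq]]]; split; first exact: inVD.
exists (fun l z => p l z + q l z); split => [l||nu z]; first exact: inVD.
  by rewrite pf qg.
rewrite BerD; [|exact: adm_inV Vf|exact: adm_inV Vg].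
rewrite mulrDr ep eq -big_split; apply: eq_bigr => l _ /=.
by rewrite mulrDr.
Qed.

Lemma expandableZ mu (a : C) f : expandable mu f -> expandable mu (fun z => a * f z).
Proof.
move=> [Vf [p [Vp pf ep]]]; split; first exact: inVZ.
exists (fun l z => a * p l z); split => [l||nu z]; first exact: inVZ.
  by rewrite pf.
rewrite BerZ; last exact: adm_inV Vf.
by rewrite mulrCA ep mulr_sumr; apply: eq_bigr => l _; rewrite mulrCA.
Qed.

Lemma expandable0 mu : expandable mu (fun=> 0).
Proof.
split; first exact: inV0.
exists (fun _ _ => 0); split => // [_|nu z]; first exact: inV0.
rewrite big1 => [|l _]; last by rewrite mulr0.
rewrite (_ : (fun=> 0) = (fun z : C => 0 * (0 : C))); last by apply/funext => w; rewrite mul0r.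
by rewrite (BerZ nu 0 z (adm_cst (0 : C))) mul0r mulr0.
Qed.

Lemma expandable_sum mu (I : Type) (r : seq I) (F : I -> C -> C) :
  (forall i, expandable mu (F i)) -> expandable mu (fun z => \sum_(i <- r) F i z).
Proof.
move=> VF; elim: r => [|i r ih]; first by under eq_fun do rewrite big_nil; exact: expandable0.
by under eq_fun do rewrite big_cons; exact: expandableD.
Qed.

Lemma expandable_sig mu u v : expandable mu (fun z => sig u v z ^+ mu).
Proof.
split; first exact: inV_sigX.
exists (fun l z => 'C(mu, l)%:R * (1 + u^* * v) ^+ (mu - l) * sig u v z ^+ l).
split => [l||nu z]; last exact: Ber_sigX.
  by apply: inVZ; apply: inV_sigX; rewrite -ltnS.
by apply/funext => z /=; rewrite binn subnn expr0 !mul1r.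
Qed.

Lemma inV_expandable mu f : inV mu f -> expandable mu f.
Proof.
move=> [c ->]; apply: expandable_sum => a; apply: expandable_sum => b.
apply: expandableZ; have [lam lamE] := power_span mu.
(* Apply [power_span] to z and to conj(z) separately; the nodes are real, so each product of powers
   over W^mu is a power of [sig]. *)
have -> : mono a b mu = (fun z : C => \sum_(i < mu.+1) \sum_(j < mu.+1)
   lam a i * lam b j * sig i%:R j%:R z ^+ mu).
  apply/funext => z; rewrite /mono (lamE a z) (lamE b z^*) big_distrlr /= mulr_suml.
  apply: eq_bigr => i _; rewrite mulr_suml; apply: eq_bigr => j _.
  by rewrite /sig !exprMn -wtVX conjC_nat; ring.
apply: expandable_sum => i; apply: expandable_sum => j; apply: expandableZ.
exact: expandable_sig.
Qed.

End Berezin.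

(** * Limits of complex sequences and of binomial ratios *)

Section Limits.
Variable R : realType.
Local Notation C := R[i].
Implicit Types (a b : nat -> C) (l m : C).

Definition ctends a l := forall e : R, 0 < e -> exists N : nat, forall n, (N <= n)%N ->
  normc (a n - l) < e.

Lemma ctends_cst l : ctends (fun=> l) l.
Proof. by move=> e e0; exists 0%N => n _; rewrite subrr modc0. Qed.

Lemma ctendsD a b l m : ctends a l -> ctends b m -> ctends (fun n => a n + b n) (l + m).
Proof.
move=> al bm e e0; have e2 : 0 < e / 2 by rewrite divr_gt0.
have [N hN] := al _ e2; have [M hM] := bm _ e2; exists (maxn N M) => n.
rewrite geq_max => /andP[/hN h1 /hM h2].
rewrite (_ : _ - _ = (a n - l) + (b n - m)); last by ring.
by rewrite (le_lt_trans (modcD _ _))// (splitr e) ltrD.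
Qed.

Lemma ctendsZ (c : C) a l : ctends a l -> ctends (fun n => c * a n) (c * l).
Proof.
move=> al e e0; have c0 : 0 < normc c + 1 by rewrite ltr_wpDl ?modc_ge0.
have [N hN] := al _ (divr_gt0 e0 c0); exists N => n /hN h.
rewrite -mulrBr modcM; apply: (@le_lt_trans _ _ ((normc c + 1) * normc (a n - l))).
  by rewrite ler_wpM2r ?modc_ge0// lerDl.
by rewrite mulrC -ltr_pdivlMr.
Qed.

Lemma ctends_bounded a l : ctends a l -> exists N (B : R), 0 < B /\
  forall n, (N <= n)%N -> normc (a n) <= B.
Proof.
move=> al; have [N hN] := al 1 ltr01; exists N, (normc l + 1).
split; first by rewrite ltr_wpDl ?modc_ge0.
move=> n /hN h; rewrite -[a n](subrK l) addrC.
by apply: (le_trans (modcD _ _)); rewrite lerD2l ltW.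
Qed.

Lemma ctendsM a b l m : ctends a l -> ctends b m -> ctends (fun n => a n * b n) (l * m).
Proof.
move=> al bm.
have [N0 [B [B0 hB]]] := ctends_bounded al.
have h : ctends (fun n => a n * (b n - m)) 0.
  move=> e e0; have [N hN] := bm _ (divr_gt0 e0 B0).
  exists (maxn N0 N) => n; rewrite geq_max => /andP[/hB h1 /hN h2].
  rewrite subr0 modcM; apply: (@le_lt_trans _ _ (B * normc (b n - m))).
    by rewrite ler_wpM2r ?modc_ge0.
  by rewrite mulrC -ltr_pdivlMr.
have := ctendsD h (ctendsZ m al); rewrite add0r mulrC.
by congr ctends; apply/funext => n; ring.
Qed.

Lemma ctends_sum (I : Type) (r : seq I) (F : I -> nat -> C) (L : I -> C) :
  (forall i, ctends (F i) (L i)) ->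
  ctends (fun n => \sum_(i <- r) F i n) (\sum_(i <- r) L i).
Proof.
move=> h; elim: r => [|i r ih].
  by rewrite big_nil; under eq_fun do rewrite big_nil; exact: ctends_cst.
by rewrite big_cons; under eq_fun do rewrite big_cons; exact: ctendsD.
Qed.

Lemma ctends_prod (I : Type) (r : seq I) (F : I -> nat -> C) (L : I -> C) :
  (forall i, ctends (F i) (L i)) ->
  ctends (fun n => \prod_(i <- r) F i n) (\prod_(i <- r) L i).
Proof.
move=> h; elim: r => [|i r ih].
  by rewrite big_nil; under eq_fun do rewrite big_nil; exact: ctends_cst.
by rewrite big_cons; under eq_fun do rewrite big_cons; exact: ctendsM.
Qed.

Lemma ctends_comp a l (f : nat -> nat) :
  (forall N, exists M, forall n, (M <= n)%N -> (N <= f n)%N) ->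
  ctends a l -> ctends (fun n => a (f n)) l.
Proof.
move=> hf al e /al[N hN]; have [M hM] := hf N.
by exists M => n /hM /hN.
Qed.

Lemma ctends_near a b l : (exists N, forall n, (N <= n)%N -> a n = b n) ->
  ctends a l -> ctends b l.
Proof.
move=> [N hN] al e /al[M hM]; exists (maxn N M) => n.
by rewrite geq_max => /andP[/hN <- /hM].
Qed.

Lemma ctends_inv (b : nat) : ctends (fun n => (n + b)%:R^-1) 0.
Proof.
move=> e e0; exists (Num.truncn e^-1).+1 => n hn; rewrite subr0.
have n0 : (0 < n)%N by apply: leq_trans hn.
have -> : ((n + b)%:R^-1 : C) = (((n + b)%:R)^-1)%:C by rewrite fmorphV /= rmorph_nat.
rewrite modc_real ger0_norm ?invr_ge0// invf_plt ?posrE ?ltr0n ?addn_gt0 ?n0//.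
apply: (@lt_le_trans _ _ (Num.truncn e^-1).+1%:R); first exact: truncnS_gt.
by rewrite ler_nat (leq_trans hn)// leq_addr.
Qed.

Lemma ctends_ratioD (c b : nat) : ctends (fun n => (n + c)%:R / (n + b)%:R) 1.
Proof.
have := ctendsD (ctends_cst 1) (ctendsZ (c%:R - b%:R) (ctends_inv b)).
rewrite mulr0 addr0; apply: ctends_near; exists 1%N => n n1.
have x0 : ((n + b)%:R : C) != 0 by rewrite pnatr_eq0; lia.
apply: (mulIf x0); rewrite mulrDl -!mulrA mulVf// !natrD; ring.
Qed.

Lemma ctends_ratioB (c b : nat) : ctends (fun n => (n - c)%:R / (n + b)%:R) 1.
Proof.
have := ctendsD (ctends_cst 1) (ctendsZ (- (c%:R + b%:R)) (ctends_inv b)).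
rewrite mulr0 addr0; apply: ctends_near; exists c.+1 => n n1.
have x0 : ((n + b)%:R : C) != 0 by rewrite pnatr_eq0; lia.
apply: (mulIf x0); rewrite mulrDl -!mulrA mulVf// natrB ?(ltnW n1)// !natrD; ring.
Qed.

Lemma ctends_bin_ratio (q : nat) (b : nat -> nat) (l : nat) : (l <= q)%N ->
  ctends (fun n => ('C(n, l) * l`!)%:R / \prod_(i < q) (n + b i)%:R) (l == q)%:R.
Proof.
move=> lq.
(* The l factors of the falling factorial are padded with ones to q factors; a genuine factor gives
   a ratio tending to 1, a padded one a ratio tending to 0. *)
pose F (i : 'I_q) (n : nat) : C := (if (i < l)%N then (n - i)%:R else 1) / (n + b i)%:R.
pose L (i : 'I_q) : C := if (i < l)%N then 1 else 0.
have FL i : ctends (F i) (L i).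
  rewrite /F /L; case: ifP => _; first exact: ctends_ratioB.
  by under eq_fun do rewrite mul1r; exact: ctends_inv.
have := ctends_prod (index_enum 'I_q) FL.
have -> : \prod_(i < q) L i = (l == q)%:R.
  have [lqe|ne] := eqVneq l q.
    by rewrite big1// => i _; rewrite /L lqe ltn_ord.
  have lq' : (l < q)%N by rewrite ltn_neqAle ne lq.
  by rewrite (bigD1 (Ordinal lq'))//= {1}/L /= ltnn mul0r.
congr ctends; apply/funext => n; rewrite /F prodf_div; congr (_ / _).
rewrite bin_ffact ffact_prod natr_prod.
rewrite -big_mkcond /= -(big_ord_widen q (fun i => (n - i)%:R : C) lq).
by [].
Qed.

Lemma ctends_alpha mu (l : 'I_mu.+1) : ctends (fun nu => alpha R mu nu l) (l == ord_max)%:R.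
Proof.
have lm : (l <= mu)%N by rewrite -ltnS.
have f0 k : (k`!%:R : C) != 0 by rewrite pnatr_eq0 -lt0n fact_gt0.
(* The shifts are mu - i because mu! C(nu+mu, mu) is the product of the nu + mu - i for i < mu. *)
have h := ctendsM (ctends_ratioD 1 mu.+1)
  (ctendsZ (mu`!%:R / l`!%:R) (ctends_bin_ratio (fun i => mu - i)%N lm)).
have -> : (l == ord_max)%:R = 1 * (mu`!%:R / l`!%:R * (l == mu :> nat)%:R) :> C.
  rewrite -(inj_eq val_inj) /=; case: eqP => [->|_]; last by rewrite !mulr0.
  by rewrite mulfV// !mulr1.
move: h; congr ctends; apply/funext => n; rewrite /alpha addn1 addnS; congr (_ * _).
have -> : \prod_(i < mu) (n + (mu - i))%:R = ('C(n + mu, mu) * mu`!)%:R :> C.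
  rewrite bin_ffact ffact_prod natr_prod; apply: eq_bigr => i _.
  by rewrite addnBA// ltnW.
have c0 : ('C(n + mu, mu)%:R : C) != 0 by rewrite pnatr_eq0 -lt0n bin_gt0 leq_addl.
have := f0 l; have := f0 mu; rewrite !natrM.
move: ('C(n + mu, mu)%:R : C) c0 (mu`!%:R : C) (l`!%:R : C) => c c0 x y x0 y0; field.
by rewrite c0 x0 y0.
Qed.

End Limits.

(* By Cayley-Hamilton, the inverse of A is a polynomial in A. *)
Lemma stable_inv (F : fieldType) n (K : 'rV[F]_n -> Prop) (A : 'M[F]_n) :
  K 0 -> (forall a c d, K c -> K d -> K (a *: c + d)) -> A \in unitmx ->
  (forall d, K d -> K (d *m A)) -> forall d, K (d *m A) -> K d.
Proof.
move=> K0 Kl; case: n => [|n] in K A K0 Kl * => Au KA d KdA; first by rewrite thinmx0.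
have Kh (p : {poly F}) c : K c -> K (c *m horner_mx A p).
  elim/poly_ind: p c => [|p a ih] c Kc; first by rewrite rmorph0 mulmx0.
  rewrite rmorphD rmorphM /= horner_mx_C horner_mx_X mulmxDr mul_mx_scalar addrC mulmxA.
  by apply: Kl => //; apply: KA; exact: ih.
have [q [a e]] : exists q a, char_poly A = q * 'X + a%:P.
  by elim/poly_ind: (char_poly A) => [|q a _]; [exists 0, 0; rewrite mul0r addr0|exists q, a].
have a0 : a != 0.
  have := char_poly_det A; rewrite e coefD coefMX coefC eqxx add0r => ->.
  rewrite mulf_neq0 ?signr_eq0//.
  by move: Au; rewrite unitmxE unitfE.
have : d *m horner_mx A (char_poly A) = 0 by rewrite Cayley_Hamilton mulmx0.
rewrite e mulrC rmorphD rmorphM /= horner_mx_C horner_mx_X mulmxDr mul_mx_scalar mulmxA.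
move=> /eqP; rewrite addrC addr_eq0 => /eqP h.
have -> : d = (- a^-1) *: (d *m A *m horner_mx A q) + 0.
  by rewrite addr0 scaleNr -scalerN -h scalerA mulVf// scale1r.
by apply: Kl => //; exact: Kh.
Qed.

Lemma eventually_all (I : finType) (P : I -> nat -> Prop) :
  (forall i, exists N, forall n, (N <= n)%N -> P i n) ->
  exists N, forall n, (N <= n)%N -> forall i, P i n.
Proof.
move=> /choice[f hf]; exists (\max_i f i) => n hn i.
by apply: hf; apply: leq_trans hn; exact: leq_bigmax.
Qed.

(** * Perturbation of the identity on a finite spanning family *)

Section Perturbation.
Variable R : realType.
Local Notation C := R[i].
Variables (n : nat) (phi : 'I_n -> C -> C) (B : R).
Hypothesis phiB : forall i z, normc (phi i z) <= B.
Hypothesis B0 : 0 < B.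

Definition comb (d : 'rV[C]_n) (z : C) : C := \sum_i d 0 i * phi i z.
Definition l1 (d : 'rV[C]_n) : R := \sum_i normc (d 0 i).

Lemma l1_ge0 d : 0 <= l1 d. Proof. by apply: sumr_ge0 => i _; exact: modc_ge0. Qed.

Lemma l1D c d : l1 (c + d) <= l1 c + l1 d.
Proof.
by rewrite -big_split; apply: ler_sum => i _; rewrite mxE; exact: modcD.
Qed.

Lemma l1N d : l1 (- d) = l1 d.
Proof. by apply: eq_bigr => i _; rewrite mxE modcN. Qed.

Lemma l1_eq0 d : l1 d <= 0 -> d = 0.
Proof.
move=> h; apply/rowP => i; rewrite mxE; apply/eqP; rewrite -modc_eq0.
rewrite eq_le modc_ge0 andbT; apply: le_trans h.
by rewrite /l1 (bigD1 i)//= lerDl; apply: sumr_ge0 => j _; exact: modc_ge0.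
Qed.

(** Matrices act on row vectors from the right, so the operator norm for [l1] is governed by row
    sums. *)
Lemma l1_mul d (E : 'M[C]_n) (e : R) : 0 <= e ->
  (forall i, \sum_j normc (E i j) <= e) -> l1 (d *m E) <= e * l1 d.
Proof.
move=> e0 Ee; rewrite /l1 mulr_sumr.
apply: (@le_trans _ _ (\sum_j \sum_i normc (d 0 i) * normc (E i j))).
  apply: ler_sum => j _; rewrite mxE; apply: (le_trans (modc_sum _)).
  by apply: ler_sum => i _; rewrite modcM.
rewrite exchange_big; apply: ler_sum => i _.
by rewrite -mulr_sumr mulrC ler_wpM2r ?modc_ge0.
Qed.

Lemma modc_comb d z : normc (comb d z) <= B * l1 d.
Proof.
apply: (le_trans (modc_sum _)); rewrite /l1 mulr_sumr; apply: ler_sum => i _.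
by rewrite modcM mulrC ler_wpM2r ?modc_ge0.
Qed.

Lemma combD c d z : comb (c + d) z = comb c z + comb d z.
Proof. by rewrite -big_split; apply: eq_bigr => i _; rewrite mxE mulrDl. Qed.

Lemma combN d z : comb (- d) z = - comb d z.
Proof. by rewrite -sumrN; apply: eq_bigr => i _; rewrite mxE mulNr. Qed.

Lemma combZ a d z : comb (a *: d) z = a * comb d z.
Proof. by rewrite mulr_sumr; apply: eq_bigr => i _; rewrite mxE mulrA. Qed.

Lemma comb0 z : comb 0 z = 0.
Proof. by rewrite -[0 in LHS](scale0r 0) combZ mul0r. Qed.

Lemma l1_cvg (c : nat -> 'rV[C]_n) (c0 : 'rV[C]_n) : (forall i, ctends (fun nu => c nu 0 i) (c0 0 i)) ->
  forall e : R, 0 < e -> exists N, forall nu, (N <= nu)%N -> l1 (c nu - c0) <= e.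
Proof.
move=> cc e e0; have e1 : 0 < e / n.+1%:R by rewrite divr_gt0.
have [N hN] := eventually_all (fun i => cc i _ e1).
exists N => nu /hN h; apply: (@le_trans _ _ (\sum_(i < n) e / n.+1%:R)).
  by apply: ler_sum => i _; rewrite !mxE ltW.
rewrite sumr_const card_ord -[_ *+ n]mulr_natr -mulrA.
apply: ler_piMr; first exact: ltW.
by rewrite mulrC ler_pdivrMr ?ltr0n// mul1r ler_nat.
Qed.

(** Write A = 1 + E with row sums of E at most dl <= 1/2. Then A is injective, w = c A^-1 has
    l1-norm at most twice that of c, and w - c0 = (c - c0) - w E is small. As [phi] may be
    dependent, the second clause is stated for every solution d. *)
Lemma perturbation (A : nat -> 'M[C]_n) (c : nat -> 'rV[C]_n) (c0 : 'rV[C]_n)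
    (T : nat -> (C -> C) -> C -> C) :
  (forall i j, ctends (fun nu => A nu i j) (i == j)%:R) ->
  (forall i, ctends (fun nu => c nu 0 i) (c0 0 i)) ->
  (forall nu d, T nu (comb d) = comb (d *m A nu)) ->
  forall e : R, 0 < e -> exists N, forall nu, (N <= nu)%N ->
    (exists d, T nu (comb d) = comb (c nu)) /\
    (forall d, T nu (comb d) = comb (c nu) -> forall z, normc (comb d z - comb c0 z) < e).
Proof.
move=> hA hc hT e e0; pose M := l1 c0 + 1.
have M0 : 0 < M by rewrite ltr_wpDl ?l1_ge0.
(* Chosen so that B x (1 + 2 M) = e / 2: eventually M bounds [l1 (c nu)], 2 M bounds [l1 w], and dl
   (1 + 2 M) bounds [l1 (w - c0)]. *)
pose x := e / (B * (1 + 2 * M)) / 2.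
have q0 : 0 < B * (1 + 2 * M) by rewrite mulr_gt0// addr_gt0// mulr_gt0.
have x0 : 0 < x by rewrite !divr_gt0.
pose dl := Num.min (1 / 2) x.
have dl0 : 0 < dl by rewrite lt_min x0 divr_gt0.
have dlh : dl <= 1 / 2 by rewrite ge_min lexx.
have dlx : dl <= x by rewrite ge_min lexx orbT.
have [N1 hN1] := l1_cvg hc dl0.
have [N2 hN2] : exists N, forall nu, (N <= nu)%N -> forall i,
    \sum_j normc ((A nu - 1%:M) i j) <= dl.
  apply: eventually_all => i.
  have hr : forall j, ctends (fun nu => (row i (A nu)) 0 j) ((row i 1%:M : 'rV[C]_n) 0 j).
    move=> j; under eq_fun do rewrite mxE; rewrite !mxE; exact: hA.
  have [N hN] := l1_cvg hr dl0; exists N => nu /hN; apply: le_trans.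
  by apply: ler_sum => j _; rewrite !mxE.
exists (maxn N1 N2) => nu; rewrite geq_max => /andP[/hN1 h1 /hN2 h2].
pose E := A nu - 1%:M.
have AE v : v *m A nu = v + v *m E by rewrite mulmxBr mulmx1 addrC subrK.
have lE v : l1 (v *m E) <= dl * l1 v by apply: l1_mul => //; exact: ltW.
have Au : A nu \in unitmx.
  rewrite -row_free_unit; apply: inj_row_free => v; rewrite AE => /eqP.
  rewrite addr_eq0 => /eqP ve; apply: l1_eq0.
  have := lE v; rewrite -(l1N (v *m E)) -ve => h; have := l1_ge0 v.
  have : dl * l1 v <= 1 / 2 * l1 v by rewrite ler_wpM2r ?l1_ge0.
  lra.
pose w := c nu *m invmx (A nu).
have wA : w *m A nu = c nu by rewrite mulmxKV.
split; first by exists w; rewrite hT wA.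
move=> d; rewrite hT => hd z.
(* d and w may differ by a relation among the [phi]. Relations are stable under [A nu] because
   [T nu] acts on functions, and (d - w) A is one, so [stable_inv] applies. *)
have cK : comb (d - w) = (fun=> 0).
  apply: (@stable_inv _ _ (fun v => comb v = (fun=> 0)) (A nu)) => //.
  - by apply/funext => y; exact: comb0.
  - by move=> a u v hu hv; apply/funext => y; rewrite combD combZ hu hv mulr0 addr0.
  - move=> v hv; rewrite -hT hv.
    have <- : comb 0 = (fun=> 0) by apply/funext => y; exact: comb0.
    by rewrite hT mul0mx.
  - by apply/funext => y; rewrite mulmxBl combD combN hd wA subrr.
have -> : comb d z - comb c0 z = comb (w - c0) z.
  rewrite combD combN -[d](subrK w) combD cK add0r.
  by [].
apply: (le_lt_trans (modc_comb _ _)).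
have cM : l1 (c nu) <= M.
  rewrite -[c nu](subrK c0); apply: (le_trans (l1D _ _)); rewrite addrC lerD2l.
  apply: (le_trans h1); lra.
have wE : w + w *m E = c nu by rewrite -AE.
have lw : l1 w <= 2 * M.
  have -> : w = c nu - w *m E by rewrite -wE addrK.
  have := l1D (c nu) (- (w *m E)); rewrite l1N => h3.
  have h4 := lE w.
  have h5 : dl * l1 w <= 1 / 2 * l1 w by rewrite ler_wpM2r ?l1_ge0.
  have h6 : l1 w <= l1 (c nu) + l1 (w *m E).
    by move: h3; rewrite -wE addrK.
  by apply: (le_trans h3); lra.
have lwc : l1 (w - c0) <= dl * (1 + 2 * M).
  have -> : w - c0 = (c nu - c0) + - (w *m E).
    by rewrite -wE addrAC addrK.
  apply: (le_trans (l1D _ _)); rewrite l1N mulrDr mulr1; apply: lerD => //.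
  by apply: (le_trans (lE w)); rewrite ler_wpM2l// ltW.
apply: (@le_lt_trans _ _ (B * (x * (1 + 2 * M)))).
  rewrite ler_wpM2l ?(ltW B0)//; apply: (le_trans lwc); rewrite ler_wpM2r//.
  by rewrite addr_ge0// mulr_ge0// ltW.
have -> : B * (x * (1 + 2 * M)) = e / 2.
  rewrite /x; have := lt0r_neq0 q0; rewrite mulf_eq0 negb_or => /andP[b0 m0].
  by move: (1 + 2 * M) m0 => y y0; field; rewrite y0.
lra.
Qed.

End Perturbation.

(** * Convergence of the inverse Berezin transforms *)

Section InverseBerezin.
Variable R : realType.
Local Notation C := R[i].

Lemma Ber_sum tau (I : Type) (r : seq I) (F : I -> C -> C) (z : C) :
  (forall i, adm 0 (F i)) ->
  Ber tau (fun s => \sum_(i <- r) F i s) z = \sum_(i <- r) Ber tau (F i) z.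
Proof.
move=> aF; elim: r => [|i r ih].
  rewrite big_nil (_ : (fun s => _) = (fun s : C => 0 * (0 : C))).
    by rewrite (BerZ tau 0 z (adm_cst (0 : C))) mul0r.
  by apply/funext => s; rewrite big_nil mul0r.
rewrite big_cons -ih -BerD//; last exact: adm_sum.
by congr Ber; apply/funext => s; rewrite big_cons.
Qed.

Section Basis.
Variable mu : nat.
Local Notation I := ('I_mu.+1 * 'I_mu.+1)%type.
Local Notation N := #|{: I}|.

Definition vbase (i : 'I_N) : C -> C := mono (enum_val i).1 (enum_val i).2 mu.

Lemma modc_vbase i z : normc (vbase i z) <= 1.
Proof.
apply: (le_trans (modc_mono_le (k := 0) _ _)); last by rewrite expr0 invr1.
have := ltn_ord (enum_val i).1; have := ltn_ord (enum_val i).2; lia.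
Qed.

Lemma inV_vbase i : inV mu (vbase i).
Proof. by apply: inV_mono; rewrite -ltnS. Qed.

Lemma inV_comb f : inV mu f <-> exists d, f = comb vbase d.
Proof.
split=> [[c ->]|[d ->]].
  exists (\row_i c (enum_val i).1 (enum_val i).2); apply/funext => z.
  rewrite pair_bigA /= /comb (reindex (@enum_val _ (mem {: I})))/=; last first.
    exact/onW_bij/enum_val_bij.
  by apply: eq_bigr => i _; rewrite mxE.
by apply: inV_sum => i; apply: inVZ; exact: inV_vbase.
Qed.

Lemma comb_delta i : comb vbase (delta_mx 0 i) = vbase i.
Proof.
apply/funext => z; rewrite /comb (bigD1 i)//= big1 => [|j /negbTE ji].
  by rewrite mxE !eqxx mul1r addr0.
by rewrite mxE eqxx ji mul0r.
Qed.

Lemma comb_sum (J : finType) (b : J -> C) (d : J -> 'rV[C]_N) z :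
  comb vbase (\sum_j b j *: d j) z = \sum_j b j * comb vbase (d j) z.
Proof.
rewrite /comb; under [RHS]eq_bigr => j _ do rewrite mulr_sumr.
rewrite exchange_big; apply: eq_bigr => i _.
rewrite summxE mulr_suml; apply: eq_bigr => j _.
by rewrite mxE mulrA.
Qed.

(** Both limits are instances: the argument of the inverse is a combination of fixed functions [H j]
    with convergent coefficients, and the level [tau nu] tends to infinity. *)
Lemma BerInv_cvg (tau : nat -> nat) (h : nat -> C -> C) (J : finType)
    (beta : J -> nat -> C) (b : J -> C) (H : J -> C -> C) (N0 : nat) :
  (forall M, exists M', forall n, (M' <= n)%N -> (M <= tau n)%N) ->
  (forall j, inV mu (H j)) -> (forall j, ctends (beta j) (b j)) ->
  (forall nu, (N0 <= nu)%N -> h nu = (fun z => \sum_j beta j nu * H j z)) ->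
  unif_cvg (fun nu => BerInv mu ((tau nu).+1%:R) (tau nu) (h nu))
           (fun z => \sum_j b j * H j z).
Proof.
move=> tauy VH hb hh e e0.
have /choice[psi hpsi] := fun i : 'I_N => proj2 (inV_expandable (inV_vbase i)).
(* Coordinates are not unique; for the top term the unit vector is chosen, so that the matrices
   converge to the identity itself and not merely modulo relations. *)
have /choice[D hD] : forall p : 'I_N * 'I_mu.+1, exists d,
    psi p.1 p.2 = comb vbase d /\ (p.2 = ord_max -> d = delta_mx 0 p.1).
  move=> [i l] /=; have [Vp pf _] := hpsi i.
  have [->|ne] := eqVneq l ord_max.
    by exists (delta_mx 0 i); rewrite comb_delta pf.
  have [d ->] := proj1 (inV_comb _) (Vp l).
  by exists d; split=> // lm; rewrite lm eqxx in ne.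
have /choice[dH hdH] := fun j => proj1 (inV_comb (H j)) (VH j).
pose A nu : 'M[C]_N := \matrix_(i, j) \sum_(l < mu.+1) alpha R mu (tau nu) l * D (i, l) 0 j.
pose T nu (g : C -> C) z := (tau nu).+1%:R * Ber (tau nu) g z.
have hT nu d : T nu (comb vbase d) = comb vbase (d *m A nu).
  apply/funext => z; rewrite /T /comb Ber_sum => [|i]; last first.
    by apply: admZ; apply: adm_inV (inV_vbase i).
  rewrite mulr_sumr.
  transitivity (\sum_i \sum_j d 0 i * A nu i j * vbase j z); last first.
    rewrite exchange_big; apply: eq_bigr => j _.
    by rewrite mxE mulr_suml.
  apply: eq_bigr => i _; rewrite BerZ; last exact: adm_inV (inV_vbase i).
  have [_ _ ep] := hpsi i; rewrite mulrCA ep mulr_sumr.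
  transitivity (\sum_(l < mu.+1) \sum_j d 0 i * (alpha R mu (tau nu) l * D (i, l) 0 j) * vbase j z).
    apply: eq_bigr => l _; rewrite (proj1 (hD (i, l))) /comb !mulr_sumr.
    by apply: eq_bigr => j _; rewrite !mulrA.
  rewrite exchange_big; apply: eq_bigr => j _.
  by rewrite mxE mulr_sumr mulr_suml.
have hA i j : ctends (fun nu => A nu i j) (i == j)%:R.
  under eq_fun do rewrite mxE.
  have -> : (i == j)%:R = \sum_(l < mu.+1) (l == ord_max)%:R * D (i, l) 0 j :> C.
    rewrite (bigD1 ord_max)//= big1 => [|l /negbTE ->]; last by rewrite mul0r.
    by rewrite eqxx mul1r addr0 (proj2 (hD (i, ord_max)))// mxE eqxx eq_sym.
  apply: ctends_sum => l; apply: ctendsM; last exact: ctends_cst.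
  exact: (ctends_comp tauy (@ctends_alpha R mu l)).
pose c nu : 'rV[C]_N := \sum_j beta j nu *: dH j.
pose c0 : 'rV[C]_N := \sum_j b j *: dH j.
have hc i : ctends (fun nu => c nu 0 i) (c0 0 i).
  under eq_fun do rewrite /c summxE; rewrite /c0 summxE.
  apply: ctends_sum => j; under eq_fun do rewrite mxE; rewrite mxE.
  by apply: ctendsM; [exact: hb|exact: ctends_cst].
have [N1 hN1] := perturbation modc_vbase ltr01 hA hc hT e0.
exists (maxn N0 N1) => nu; rewrite geq_max => /andP[/hh hE /hN1[[d hd] hu]] z.
have hcE : h nu = comb vbase (c nu).
  by rewrite hE; apply/funext => y; rewrite comb_sum; apply: eq_bigr => j _; rewrite -hdH.
(* The solution d shows that the choice in [BerInv] is a genuine preimage; [hu] then controls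
   whichever preimage was chosen. *)
have := @ClassicalEpsilon.epsilon_spec _ (inhabits (fun _ : C => 0)) (fun g => ImR mu g /\
   (fun z => (tau nu).+1%:R * Ber (tau nu) g z) = h nu).
case.
  exists (comb vbase d); split; last by rewrite hcE -hd.
  by apply/ImR_inV/inV_comb; exists d.
rewrite -/(BerInv mu _ _ _) => /ImR_inV/inV_comb[d' ->] h'.
have -> : \sum_j b j * H j z = comb vbase c0 z.
  by rewrite comb_sum; apply: eq_bigr => j _; rewrite -hdH.
by apply: hu; rewrite -hcE -h'.
Qed.

End Basis.
End InverseBerezin.

(** * The tensor product in coordinates and the reproducing property *)

Section TensorPairing.
Variable R : realType.
Local Notation C := R[i].

(** A two-variable polynomial as a polynomial in w with coefficients [p b] in z; the sequence is
    read only for b <= nu. *)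
Definition tpoly nu (p : nat -> {poly C}) (z w : C) : C :=
  \sum_(b < nu.+1) (p b).[z] * w ^+ b.

Lemma inH2P mu nu (F : C -> C -> C) : inH2 mu nu F <->
  exists p : nat -> {poly C}, (forall b, (size (p b) <= mu.+1)%N) /\ F = tpoly nu p.
Proof.
split=> [[q [sq [sq' ->]]]|[p [sp ->]]].
  exists (fun b => q`_b); split=> //; apply/funext => z; apply/funext => w.
  rewrite (horner_coef_wide _ sq) horner_sum; apply: eq_bigr => b _.
  by rewrite hornerM -rmorphXn hornerC.
exists (\poly_(b < nu.+1) p b); split; first exact: size_poly.
split=> [i|]; first by rewrite coef_poly; case: ifP => // _; rewrite size_poly0.
apply/funext => z; apply/funext => w.
rewrite horner_poly horner_sum; apply: eq_bigr => b _.
by rewrite hornerM -rmorphXn hornerC.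
Qed.

Definition tpair mu nu (p q : nat -> {poly C}) : C :=
  \sum_(b < nu.+1) 'C(nu, b)%:R^-1 * ipp mu (p b) (q b).

Lemma ip2_tpoly mu nu (p q : nat -> {poly C}) :
  (forall b, (size (p b) <= mu.+1)%N) -> (forall b, (size (q b) <= mu.+1)%N) ->
  ip2 mu nu (tpoly nu p) (tpoly nu q) = tpair mu nu p q.
Proof.
move=> sp sq; rewrite /ip2 /iint2.
have e r (z w : C) : tpoly nu r z w = (\poly_(b < nu.+1) (r b).[z]).[w].
  by rewrite horner_poly.
rewrite (@eq_iint _ _ _ (fun z => \sum_(b < nu.+1)
    'C(nu, b)%:R^-1 * ((p b).[z] * ((q b).[z])^*))); last first.
  move=> z; under eq_fun do rewrite !e.
  rewrite iint_poly ?size_poly//; apply: eq_bigr => b _.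
  by rewrite !coef_poly ltn_ord mulrC.
have a b : adm (2 * mu) (fun z => (p b).[z] * ((q b).[z])^*).
  by have := admM (adm_poly (sp b)) (admJ (adm_poly (sq b))); rewrite mul2n addnn.
rewrite iint_sum => [|b]; last exact: admZ.
by apply: eq_bigr => b _; rewrite iintZ// iint_poly.
Qed.

Lemma tpair_sumr mu nu p (J : finType) (c : J -> C) (q : J -> nat -> {poly C}) :
  tpair mu nu p (fun b => \sum_j c j *: q j b) = \sum_j (c j)^* * tpair mu nu p (q j).
Proof.
rewrite /tpair; under [RHS]eq_bigr => j _ do rewrite mulr_sumr.
rewrite exchange_big; apply: eq_bigr => b _ /=.
rewrite ipp_sumr mulr_sumr; apply: eq_bigr => j _.
by rewrite ippZr mulrCA.
Qed.

Lemma ipp_inj mu (P Q : {poly C}) : (size P <= mu.+1)%N -> (size Q <= mu.+1)%N ->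
  (forall i : 'I_mu.+1, ipp mu 'X^i P = ipp mu 'X^i Q) -> P = Q.
Proof.
move=> sP sQ h.
have e (i : 'I_mu.+1) S : ipp mu 'X^i S = (S`_i)^* / 'C(mu, i)%:R.
  rewrite /ipp (bigD1 i)//= big1 => [|j]; first by rewrite coefXn eqxx mul1r addr0.
  by rewrite -(inj_eq val_inj) coefXn => /negbTE ->; rewrite !mul0r.
apply/polyP => i; have [im|im] := ltnP i mu.+1; last first.
  by rewrite !nth_default// ?(leq_trans sP)// (leq_trans sQ).
have := h (Ordinal im); rewrite !e /= => /mulIf.
by move=> /(_ (invr_neq0 (bin_neq0 R (Ordinal im))))/(can_inj conjCK).
Qed.

Lemma inH_sum n (J : Type) (r : seq J) (F : J -> C -> C) :
  (forall j, inH n (F j)) -> inH n (fun x => \sum_(j <- r) F j x).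
Proof.
move=> /choice[p hp]; exists (\sum_(j <- r) p j); split.
  elim/big_rec: _ => [|j q _ sq]; first by rewrite size_poly0.
  by rewrite (leq_trans (size_polyD _ _))// geq_max (proj1 (hp j)).
by apply/funext => x; rewrite horner_sum; apply: eq_bigr => j _; rewrite (proj2 (hp j)).
Qed.

Lemma inHZ n (a : C) h : inH n h -> inH n (fun x => a * h x).
Proof.
move=> [p [sp ->]]; exists (a *: p); split; last by apply/funext => x; rewrite hornerZ.
exact: leq_trans (size_scale_leq _ _) sp.
Qed.

Lemma inHM m n (g h : C -> C) : inH m g -> inH n h -> inH (m + n) (fun x => g x * h x).
Proof.
move=> [p [sp ->]] [q [sq ->]]; exists (p * q); split; last first.
  by apply/funext => x; rewrite hornerM.
by apply: (leq_trans (size_polyMleq _ _)); lia.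
Qed.

Lemma inH0 n : inH n (fun=> 0 : C).
Proof. by exists 0; rewrite size_poly0; split=> //; apply/funext => x; rewrite horner0. Qed.

(** Conjugation makes the dependence on xi holomorphic; this is what shows that P_k F is a
    polynomial in xi. *)
Lemma inH_coef_coh n i : inH n (fun xi : C => ((coh n xi)`_i)^*).
Proof.
have -> : (fun xi : C => ((coh n xi)`_i)^*) = (fun xi => 'C(n, i)%:R * xi ^+ i).
  apply/funext => xi; rewrite /coh coef_linX /= expr1n mulr1 rmorphM rmorphXn /=.
  by rewrite conjCK conjC_nat.
have [le|gt] := leqP i n; first by apply: inHZ; exact: inH_Xn.
by rewrite bin_small//; under eq_fun do rewrite mul0r; exact: inH0.
Qed.

Lemma repro n (h : C -> C) (xi : C) : inH n h -> ip n h (fun s => Kern n s xi) = h xi.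
Proof.
move=> [p [sp ->]]; rewrite /ip.
under eq_fun do rewrite KernE.
rewrite iint_poly ?size_linX// (horner_coef_wide _ sp); apply: eq_bigr => i _.
rewrite coef_linX /= expr1n mulr1 rmorphM rmorphXn /= conjCK conjC_nat.
by have := bin_neq0 R i; move: ('C(n, i)%:R : C) => c c0; field.
Qed.

Lemma ip_sumr n (h : C -> C) (J : finType) (c : J -> C) (g : J -> C -> C) :
  inH n h -> (forall j, inH n (g j)) ->
  ip n h (fun s => \sum_j c j * g j s) = \sum_j (c j)^* * ip n h (g j).
Proof.
move=> Hh Hg.
have a j : adm (2 * n) (fun s => h s * (g j s)^*).
  have [p [sp ->]] := Hh; have [q [sq ->]] := Hg j.
  by have := admM (adm_poly sp) (admJ (adm_poly sq)); rewrite mul2n addnn.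
rewrite /ip (@eq_iint _ _ _ (fun s => \sum_j (c j)^* * (h s * (g j s)^*))); last first.
  move=> s; rewrite rmorph_sum mulr_sumr; apply: eq_bigr => j _.
  by rewrite rmorphM mulrCA.
rewrite iint_sum => [|j]; last exact: admZ.
by apply: eq_bigr => j _; rewrite iintZ.
Qed.

End TensorPairing.

(** * The maps P_k and their adjoints *)

Section Transvectant.
Variable R : realType.
Local Notation C := R[i].
Variables (mu nu k : nat).
Hypotheses (kmu : (k <= mu)%N) (knu : (k <= nu)%N).
Local Notation m := (mu + nu - 2 * k)%N.
Local Notation cc := ((@Cmnk R mu nu k)%:C).

(** The conjugate of the kernel of J_k, so that J_k F (xi) = <F, Gx xi>. *)
Definition Gx (xi z w : C) : C :=
  (z - w) ^+ k * (1 + xi^* * z) ^+ (mu - k) * (1 + xi^* * w) ^+ (nu - k).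

(* Gw xi z is Gx xi z as a polynomial in w, and Gz xi b is the coefficient of w^b in
   it as a polynomial in z. *)
Definition Gw (xi z : C) : {poly C} :=
  ((1 + xi^* * z) ^+ (mu - k)) *: (coh (nu - k) xi * lin (z, -1) ^+ k).

Definition Gz (xi : C) (b : nat) : {poly C} :=
  (\sum_(j < k.+1) ('C(k, j)%:R * (-1) ^+ j * (if (j <= b)%N then (coh (nu - k) xi)`_(b - j) else 0))
     *: 'X^(k - j)) * coh (mu - k) xi.

Lemma size_Gw xi z : (size (Gw xi z) <= nu.+1)%N.
Proof.
rewrite /Gw /coh (leq_trans (size_scale_leq _ _))//.
by have := size_linXM (1, xi^*) (z, -1) (nu - k) k; rewrite subnK.
Qed.

Lemma GwE xi z w : (Gw xi z).[w] = Gx xi z w.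
Proof.
have e : (lin (z, -1)).[w] = z - w by rewrite /lin /= !hornerE mulN1r.
by rewrite /Gw hornerZ hornerM cohE horner_exp e /Gx; ring.
Qed.

Lemma size_Gz xi b : (size (Gz xi b) <= mu.+1)%N.
Proof.
rewrite /Gz; set S := \sum_(j < k.+1) _.
have sS : (size S <= k.+1)%N.
  rewrite /S; elim/big_rec: _ => [|j q _ sq]; first by rewrite size_poly0.
  rewrite (leq_trans (size_polyD _ _))// geq_max sq andbT.
  by rewrite (leq_trans (size_scale_leq _ _))// size_polyXn ltnS leq_subr.
have := size_linX (1, xi^*) (mu - k); rewrite -/(coh _ _) => sc.
apply: (leq_trans (size_polyMleq _ _)); rewrite -subn1 leq_subLR.
by apply: (leq_trans (leq_add sS sc)); lia.
Qed.

Lemma GzE xi b z : (Gz xi b).[z] = (Gw xi z)`_b.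
Proof.
rewrite /Gz /Gw hornerM cohE mulrC coefZ; congr (_ * _).
rewrite horner_sum mulrC coefM.
have -> : \sum_(j < k.+1) (('C(k, j)%:R * (-1) ^+ j *
   (if (j <= b)%N then (coh (nu - k) xi)`_(b - j) else 0)) *: 'X^(k - j)).[z] =
   \sum_(j < k.+1 | (j <= b)%N) (lin (z, -1) ^+ k)`_j * (coh (nu - k) xi)`_(b - j).
  rewrite [RHS]big_mkcond; apply: eq_bigr => j _; rewrite hornerZ hornerXn.
  case: ifP => _; last by rewrite mulr0 mul0r.
  by rewrite coef_linX /=; ring.
rewrite -(big_mkord (fun j => (j <= b)%N)
  (fun j => (lin (z, -1) ^+ k)`_j * (coh (nu - k) xi)`_(b - j))).
rewrite -(big_mkord xpredT (fun j => (lin (z, -1) ^+ k)`_j * (coh (nu - k) xi)`_(b - j))).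
(* Both sums effectively stop at min(b, k): on the left the condition j <= b cuts them, on the right
   the coefficients of a k-th power vanish beyond k. *)
have [bk|kb] := leqP b k.
  rewrite [LHS](@big_cat_nat _ _ _ b.+1)//= [X in _ + X]big1_seq ?addr0.
    by rewrite big_nat_cond [RHS]big_nat_cond; apply: eq_bigl => j; rewrite !ltnS; lia.
  by move=> j; rewrite mem_index_iota; lia.
rewrite [RHS](@big_cat_nat _ _ _ k.+1)//=; last by lia.
rewrite [X in _ = _ + X]big1_seq ?addr0.
  by rewrite big_nat_cond [RHS]big_nat_cond; apply: eq_bigl => j; lia.
move=> j; rewrite mem_index_iota /= => /andP[h _].
by rewrite coef_linX bin_small// !mul0r.
Qed.

Lemma Gx_tpoly xi : Gx xi = tpoly nu (Gz xi).
Proof.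
apply/funext => z; apply/funext => w; rewrite -GwE (horner_coef_wide _ (size_Gw xi z)).
by apply: eq_bigr => b _; rewrite GzE.
Qed.

Lemma inH_coef_Gz b i : inH m (fun xi => ((Gz xi b)`_i)^*).
Proof.
have mE : m = ((nu - k) + (mu - k))%N by lia.
have -> : (fun xi => ((Gz xi b)`_i)^*) = (fun xi => \sum_(j < k.+1)
   (('C(k, j)%:R * (-1) ^+ j)^*) * ((if (j <= b)%N then (coh (nu - k) xi)`_(b - j) else 0)^* *
     (if (i < k - j)%N then 0 else (coh (mu - k) xi)`_(i - (k - j)))^*)).
  apply/funext => xi; rewrite /Gz mulr_suml coef_sum rmorph_sum.
  apply: eq_bigr => j _; rewrite -scalerAl coefZ coefXnM !rmorphM /=.
  by rewrite !mulrA.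
apply: inH_sum => j; apply: inHZ; rewrite mE; apply: inHM.
  case: (j <= b)%N; first exact: inH_coef_coh.
  by under eq_fun do rewrite conjC0; exact: inH0.
case: (i < k - j)%N; last exact: inH_coef_coh.
by under eq_fun do rewrite conjC0; exact: inH0.
Qed.

Lemma Pk_tpoly (p : nat -> {poly C}) xi : (forall b, (size (p b) <= mu.+1)%N) ->
  Pk mu nu k (tpoly nu p) xi = cc * tpair mu nu p (Gz xi).
Proof.
move=> sp; rewrite /Pk -(ip2_tpoly nu sp (size_Gz xi)).
rewrite -(Gx_tpoly xi).
suff -> : Jk mu nu k (tpoly nu p) xi = ip2 mu nu (tpoly nu p) (Gx xi) by [].
rewrite /Jk /ip2 /iint2.
apply: eq_iint => z; apply: eq_iint => w.
have e (s : C) : (1 + xi^* * s)^* = 1 + xi * s^* by rewrite rmorphD rmorphM rmorph1 /= conjCK.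
have -> : (Gx xi z w)^* = (z^* - w^*) ^+ k * (1 + xi * z^*) ^+ (mu - k)
   * (1 + xi * w^*) ^+ (nu - k).
  by rewrite /Gx !rmorphM !rmorphXn /= !e rmorphB.
by rewrite !mulrA.
Qed.

(** The conjugated coefficients of [Gx xi] have degree at most (mu-k) + (nu-k) in xi. Membership in
    H_m is what allows the reproducing property to be applied to P_k F. *)
Lemma Pk_inH (p : nat -> {poly C}) : (forall b, (size (p b) <= mu.+1)%N) -> inH m (Pk mu nu k (tpoly nu p)).
Proof.
move=> sp.
have -> : Pk mu nu k (tpoly nu p) = (fun xi => cc * \sum_(b < nu.+1) 'C(nu, b)%:R^-1 *
   \sum_(i < mu.+1) ((p b)`_i / 'C(mu, i)%:R) * ((Gz xi b)`_i)^*).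
  apply/funext => xi; rewrite Pk_tpoly//; congr (_ * _); apply: eq_bigr => b _.
  by congr (_ * _); apply: eq_bigr => i _; rewrite mulrAC.
apply: inHZ; apply: inH_sum => b; apply: inHZ; apply: inH_sum => i; apply: inHZ.
exact: inH_coef_Gz.
Qed.

(* Polynomials of degree <= m are spanned by the kernels at the points 0..m, and
   P_k^* maps the kernel at xi to cc * Gx xi. *)
Lemma isPkAdj_exists : exists Q, @isPkAdj R mu nu k Q.
Proof.
have [lam lamE] := @power_span R m.
pose J := ('I_m.+1 * 'I_m.+1)%type.
(* Pairing with s^a recovers the a-th coefficient of a polynomial, since s^a has squared norm 1 /
   C(m,a). *)
pose cf (g : C -> C) (a : 'I_m.+1) := 'C(m, a)%:R * iint m (fun s => g s * (s ^+ a)^*).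
have cfE (p : {poly C}) a : (size p <= m.+1)%N -> cf (horner p) a = p`_a.
  move=> sp; rewrite /cf.
  under eq_fun do rewrite -hornerXn.
  rewrite iint_poly ?size_polyXn// /ipp (bigD1 a)//= big1 => [|j].
    rewrite coefXn eqxx conjC1 mulr1 addr0.
    by have := bin_neq0 R a; move: ('C(_, _)%:R : C) => c c0; field.
  by rewrite -(inj_eq val_inj) coefXn => /negbTE ->; rewrite conjC0 mulr0 mul0r.
pose co (g : C -> C) (j : J) := cf g j.1 * lam j.1 j.2.
pose q (g : C -> C) (b : nat) := \sum_(j : J) (cc * co g j) *: Gz j.2%:R b.
have sq g b : (size (q g b) <= mu.+1)%N.
  rewrite /q; elim/big_rec: _ => [|j r _ sr]; first by rewrite size_poly0.
  rewrite (leq_trans (size_polyD _ _))// geq_max sr andbT.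
  by rewrite (leq_trans (size_scale_leq _ _))// size_Gz.
exists (fun g => tpoly nu (q g)); split=> [g _|F g /inH2P[p [sp ->]] Hg].
  by apply/inH2P; exists (q g).
rewrite ip2_tpoly// tpair_sumr.
have gE : g = (fun s => \sum_(j : J) co g j * Kern m s j.2%:R).
  apply/funext => s; have [r [sr gr]] := Hg.
  rewrite {1}gr (horner_coef_wide _ sr) -(pair_bigA _ (fun a i => co g (a, i) * Kern m s i%:R)) /=.
  apply: eq_bigr => a _; rewrite (lamE a s) mulr_sumr; apply: eq_bigr => i _.
  by rewrite /co /= gr cfE// mulrA /Kern conjC_nat.
have HK j : inH m (fun s : C => Kern m s j).
  by exists (lin (1, j^*) ^+ m); rewrite size_linX; split=> //; apply/funext => s; rewrite KernE.
rewrite {1}gE ip_sumr//; last exact: Pk_inH.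
apply: eq_bigr => j _; rewrite repro; last exact: Pk_inH.
have e : (cc * co g j)^* = cc * (co g j)^* by rewrite rmorphM /= conj_real.
by rewrite Pk_tpoly// e; ring.
Qed.

(** Only the adjoint relation is known of the chosen [PkAdj]. Tested on the tensors z^i w^b, with
    the reproducing property on the other side, it determines every coefficient of the value at a
    kernel. *)
Lemma PkAdj_Kern xi : PkAdj mu nu k (fun s : C => Kern m s xi) = (fun z w => cc * Gx xi z w).
Proof.
have [h1 h2] : isPkAdj mu nu k (@PkAdj R mu nu k).
  exact: (@ClassicalEpsilon.epsilon_spec _ _ _ isPkAdj_exists).
have HK : inH m (fun s : C => Kern m s xi).
  by exists (lin (1, xi^*) ^+ m); rewrite size_linX; split=> //; apply/funext => s; rewrite KernE.
have /inH2P[q [sq qE]] := h1 _ HK.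
have e (b : 'I_nu.+1) : q b = cc *: Gz xi b.
  apply: (@ipp_inj _ mu) => [||i]; first exact: sq.
    by rewrite (leq_trans (size_scale_leq _ _))// size_Gz.
  (* The coefficient sequence of the tensor z^i w^b. *)
  pose p (b' : nat) : {poly C} := if b' == b then 'X^i else 0.
  have sp b' : (size (p b') <= mu.+1)%N.
    by rewrite /p; case: ifP; rewrite ?size_poly0// size_polyXn.
  have tp r : tpair mu nu p r = 'C(nu, b)%:R^-1 * ipp mu 'X^i (r b).
    rewrite /tpair (bigD1 b)//= big1 => [|b']; first by rewrite /p eqxx addr0.
    rewrite -(inj_eq val_inj) /p => /negbTE ->.
    by rewrite /ipp big1 ?mulr0// => j _; rewrite coef0 !mul0r.
  have F2 : inH2 mu nu (tpoly nu p) by apply/inH2P; exists p.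
  have := h2 _ _ F2 HK; rewrite repro; last exact: Pk_inH.
  rewrite qE ip2_tpoly// Pk_tpoly// !tp ippZr conj_real mulrCA.
  move=> /mulfI <- //.
  by rewrite invr_eq0 bin_neq0.
rewrite qE Gx_tpoly; apply/funext => z; apply/funext => w.
by rewrite /tpoly mulr_sumr; apply: eq_bigr => b _; rewrite e hornerZ mulrA.
Qed.

End Transvectant.

(** * Expansion of E^nu_{mu,k} in Berezin transforms *)

Section QuantumChannel.
Variable R : realType.
Local Notation C := R[i].
Variables (mu nu k : nat).
Hypotheses (kmu : (k <= mu)%N) (knu : (k <= nu)%N).
Local Notation m := (mu + nu - 2 * k)%N.
Local Notation cc := ((@Cmnk R mu nu k)%:C).
Local Notation W z := ((wt z)%:C).
Variable f : C -> C.
Hypothesis af : adm 0 f.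

Definition fmom (i j : nat) : C := iint mu (fun s => f s * (s ^+ i * s^* ^+ j)).

(* The Toeplitz operator R_mu^*(f), up to the factor mu + 1. *)
Definition toep (P : {poly C}) : {poly C} :=
  \poly_(j < mu.+1) ('C(mu, j)%:R * \sum_(i < mu.+1) P`_i * fmom i j).

Lemma adm_fpoly n (P Q : {poly C}) : (size P <= n.+1)%N -> (size Q <= n.+1)%N ->
  adm (2 * n) (fun s => f s * (P.[s] * (Q.[s])^*)).
Proof.
move=> sP sQ; have := admM af (admM (adm_poly sP) (admJ (adm_poly sQ))).
by rewrite add0n mul2n addnn.
Qed.

Lemma iint_toep (P : {poly C}) (z : C) : (size P <= mu.+1)%N ->
  iint mu (fun s => f s * (P.[s] * ((coh mu z).[s])^*)) = (toep P).[z].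
Proof.
move=> sP; rewrite iint_fpoly ?size_linX// exchange_big horner_poly; apply: eq_bigr => j _.
rewrite -mulrA mulr_suml mulr_sumr; apply: eq_bigr => i _.
rewrite /coh coef_linX /= expr1n mulr1 rmorphM rmorphXn /= conjCK conjC_nat /fmom.
by ring.
Qed.

(** Pairing with an element of H_mu absorbs the projection in the Toeplitz operator, leaving
    multiplication by f. *)
Lemma ipp_toep (P Q : {poly C}) : (size P <= mu.+1)%N -> (size Q <= mu.+1)%N ->
  ipp mu (toep P) Q = iint mu (fun s => f s * (P.[s] * (Q.[s])^*)).
Proof.
move=> sP sQ; rewrite iint_fpoly// exchange_big; apply: eq_bigr => j _.
rewrite coef_poly ltn_ord mulr_sumr !mulr_suml; apply: eq_bigr => i _.
have := bin_neq0 R j; rewrite /fmom; move: ('C(_, _)%:R : C) => c c0.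
by move: (iint _ _) => x; field.
Qed.

Lemma ippZl n (a : C) (P Q : {poly C}) : ipp n (a *: P) Q = a * ipp n P Q.
Proof. by rewrite mulr_sumr; apply: eq_bigr => i _; rewrite coefZ; ring. Qed.

Lemma tens_Gx xi : tensI (Rstar mu f) (fun z w => cc * Gx mu nu k xi z w) =
  tpoly nu (fun b => (cc / mu.+1%:R) *: toep (Gz mu nu k xi b)).
Proof.
apply/funext => z; apply/funext => w; rewrite /tensI /Rstar Gx_tpoly//.
have sG b : (size (Gz mu nu k xi b) <= mu.+1)%N by exact: size_Gz.
rewrite (@eq_iint _ _ _ (fun s => \sum_(b < nu.+1) (cc * w ^+ b) *
   (f s * ((Gz mu nu k xi b).[s] * ((coh mu z).[s])^*)))); last first.
  move=> s; rewrite cohJ /tpoly -!mulrA mulr_suml !mulr_sumr; apply: eq_bigr => b _.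
  by ring.
have a b : adm (2 * mu) (fun s => f s * ((Gz mu nu k xi b).[s] * ((coh mu z).[s])^*)).
  by apply: adm_fpoly => //; exact: size_linX.
rewrite iint_sum => [|b]; last exact: admZ.
rewrite mulr_sumr; apply: eq_bigr => b _; rewrite iintZ// iint_toep// hornerZ.
by ring.
Qed.

(** With A = [Rstar mu f], the symbol at xi is cc^2 <(A tensor I) Gx xi, Gx xi> / W(xi)^m. The
    pairing in the first variable becomes an integral against f, and the one in w leaves the squared
    norm of [Gw xi s]. *)
Lemma Enu_iint xi : Enu mu nu k f xi = cc ^+ 2 / mu.+1%:R / (wt xi ^+ m)%:C *
  iint mu (fun s => f s * ipp nu (Gw mu nu k xi s) (Gw mu nu k xi s)).
Proof.
rewrite /Enu /Rop /kernelOf /Top PkAdj_Kern// tens_Gx.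
have sG b : (size (Gz mu nu k xi b) <= mu.+1)%N by exact: size_Gz.
rewrite Pk_tpoly//; last first.
  by move=> b; rewrite (leq_trans (size_scale_leq _ _))// size_poly.
have a b : adm (2 * mu) (fun s => f s * ((Gz mu nu k xi b).[s] * ((Gz mu nu k xi b).[s])^*)).
  exact: adm_fpoly.
have -> : tpair mu nu (fun b => (cc / mu.+1%:R) *: toep (Gz mu nu k xi b)) (Gz mu nu k xi) =
    cc / mu.+1%:R * iint mu (fun s => f s * ipp nu (Gw mu nu k xi s) (Gw mu nu k xi s)).
  rewrite (@eq_iint _ mu (fun s => f s * ipp nu _ _) (fun s => \sum_(b < nu.+1)
    'C(nu, b)%:R^-1 * (f s * ((Gz mu nu k xi b).[s] * ((Gz mu nu k xi b).[s])^*)))); last first.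
    by move=> s; rewrite /ipp mulr_sumr; apply: eq_bigr => b _; rewrite !GzE//; ring.
  rewrite iint_sum => [|b]; last exact: admZ.
  rewrite /tpair mulr_sumr; apply: eq_bigr => b _.
  by rewrite iintZ// ippZl ipp_toep//; ring.
by rewrite expr2; ring.
Qed.

Definition Dk (xi s : C) : C := (1 + xi^* * s) * (1 + xi * s^*).

(** The identity for linear forms with a = c = (1, conj xi) and b = d = (s, -1): here <a,a> = W(xi),
    <b,b> = W(s) and <a,b><b,a> = |s - xi|^2 = W(s) W(xi) - Dk. The j-th power of the last is
    expanded binomially. *)
Lemma ipp_Gw xi s : 'C(nu, k)%:R * ipp nu (Gw mu nu k xi s) (Gw mu nu k xi s) =
  \sum_(j < k.+1) \sum_(i < j.+1)
    ('C(nu - k, j)%:R * 'C(k, j)%:R * ((-1) ^+ i * 'C(j, i)%:R) * W xi ^+ (nu - k - i))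
    * (Dk xi s ^+ (mu - k + i) * W s ^+ (k - i)).
Proof.
have e : (1 + xi^* * s)^* = 1 + xi * s^* by rewrite rmorphD rmorphM rmorph1 /= conjCK.
rewrite /Gw ippZr ippZl rmorphXn /= e.
have := ipp_lin2 (nu - k) k (1, xi^*) (s, -1) (1, xi^*) (s, -1).
rewrite subnK// -/(coh _ _) => h.
transitivity (Dk xi s ^+ (mu - k) * ('C(nu, k)%:R *
   ipp nu (coh (nu - k) xi * lin (s, -1) ^+ k) (coh (nu - k) xi * lin (s, -1) ^+ k))).
  by rewrite /Dk exprMn; ring.
rewrite h mulr_sumr; apply: eq_bigr => j _.
have [jn|nj] := leqP j (nu - k); last first.
  by rewrite (bin_small nj) !(mul0r, mulr0) big1// => i _; rewrite !mul0r.
have jk : (j <= k)%N by rewrite -ltnS.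
have -> : fpair (1, xi^*) (1, xi^*) = W xi by rewrite /fpair /= conjCK conjC1 wtC; ring.
have -> : fpair (s, -1) (s, -1) = W s by rewrite /fpair /= wtC rmorphN rmorph1; ring.
have d1 : fpair (1, xi^*) (s, -1) * fpair (s, -1) (1, xi^*) = W s * W xi - Dk xi s.
  by rewrite /fpair /= !wtC /Dk rmorphN rmorph1 conjCK; ring.
have -> : Dk xi s ^+ (mu - k) * ('C(nu - k, j)%:R * 'C(k, j)%:R *
    (W xi ^+ (nu - k - j) * fpair (1, xi^*) (s, -1) ^+ j *
    (W s ^+ (k - j) * fpair (s, -1) (1, xi^*) ^+ j))) =
  'C(nu - k, j)%:R * 'C(k, j)%:R * Dk xi s ^+ (mu - k) * W xi ^+ (nu - k - j) *
   W s ^+ (k - j) * (W s * W xi - Dk xi s) ^+ j by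
    rewrite -d1 [(fpair _ _ * fpair _ _) ^+ j]exprMn; ring.
rewrite exprBn mulr_sumr; apply: eq_bigr => i _.
have ij : (i <= j)%N by rewrite -ltnS.
have -> : (nu - k - i = (nu - k - j) + (j - i))%N by lia.
have -> : (k - i = (k - j) + (j - i))%N by lia.
by rewrite [(W s * W xi) ^+ _]exprMn !exprD -[_ *+ 'C(j, i)]mulr_natl; ring.
Qed.

Lemma adm_fDk xi t : (t <= mu)%N ->
  adm (2 * mu) (fun s => f s * (Dk xi s ^+ t * W s ^+ (mu - t))).
Proof.
move=> tm.
have aW : adm 2 (fun s : C => W s).
  under eq_fun do rewrite wtC.
  apply: admD; first by apply: adm_le (adm_cst 1).
  exact: (admM (adm_id R) (admJ (adm_id R))).
have := admM (adm_coh2 t xi af) (admX (mu - t) aW).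
have -> : (2 * t + (mu - t) * 2 = 2 * mu)%N by lia.
by congr adm; apply/funext => s; rewrite cohJ cohE /Dk exprMn; ring.
Qed.

(** The factor W(s)^(mu-t) lowers the weight of iota_mu to that of iota_t, at the cost of the ratio
    (mu+1)/(t+1) of their constants. *)
Lemma iint_Dk xi t : (t <= mu)%N ->
  iint mu (fun s => f s * (Dk xi s ^+ t * W s ^+ (mu - t))) =
  mu.+1%:R * W xi ^+ t * Ber t f xi.
Proof.
move=> tm; rewrite Ber_iint//.
transitivity (iint t (fun s => (mu.+1%:R / t.+1%:R) *
   (f s * ((coh t xi).[s] * ((coh t xi).[s])^*)))).
  rewrite /iint; congr cint; apply/funext => s.
  rewrite (iota_densC mu) (iota_densC t) cohJ cohE /Dk exprMn.
  move: (iota_dens 0 s)%:C => x; rewrite !realCV !rmorphXn /=.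
  have w0 := wtC_neq0 s; have t0 : (t.+1%:R : C) != 0 by rewrite pnatr_eq0.
  rewrite -{3}(subnK tm) exprD.
  have := expf_neq0 (mu - t) w0; have := expf_neq0 t w0.
  move: (W s ^+ (mu - t)) (W s ^+ t) (t.+1%:R : C) t0 => a b c c0 b0 a0; field.
  by rewrite a0 b0 c0.
rewrite iintZ; last exact: adm_coh2.
have w0 := wtC_neq0 xi; have t0 : (t.+1%:R : C) != 0 by rewrite pnatr_eq0.
rewrite realCV rmorphXn /=; have := expf_neq0 t w0.
move: (W xi ^+ t) (t.+1%:R : C) t0 (iint t _) => b c c0 x b0; field.
by rewrite b0 c0.
Qed.

Lemma Enu_expand xi : Enu mu nu k f xi = \sum_(j < k.+1)
  (cc ^+ 2 / 'C(nu, k)%:R * 'C(nu - k, j)%:R * 'C(k, j)%:R) *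
  \sum_(i < j.+1) (-1) ^+ i * 'C(j, i)%:R * Ber (mu - k + i) f xi.
Proof.
have c0 : ('C(nu, k)%:R : C) != 0 by rewrite pnatr_eq0 -lt0n bin_gt0.
have m0 : (mu.+1%:R : C) != 0 by rewrite pnatr_eq0.
rewrite Enu_iint.
rewrite (@eq_iint _ _ _ (fun s => \sum_(j < k.+1) \sum_(i < j.+1)
    ('C(nu, k)%:R^-1 * ('C(nu - k, j)%:R * 'C(k, j)%:R * ((-1) ^+ i * 'C(j, i)%:R)
       * W xi ^+ (nu - k - i)))
    * (f s * (Dk xi s ^+ (mu - k + i) * W s ^+ (mu - (mu - k + i)))))); last first.
  move=> s; rewrite -[ipp _ _ _](mulKf c0) ipp_Gw !mulr_sumr; apply: eq_bigr => j _.
  rewrite !mulr_sumr; apply: eq_bigr => i _.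
  have -> : (mu - (mu - k + i) = k - i)%N by lia.
  by ring.
have a (j : 'I_k.+1) (i : 'I_j.+1) :
    adm (2 * mu) (fun s => f s * (Dk xi s ^+ (mu - k + i) * W s ^+ (mu - (mu - k + i)))).
  by apply: adm_fDk; have := ltn_ord j; have := ltn_ord i; lia.
rewrite iint_sum => [|j]; last by apply: adm_sum => i _; apply: admZ; exact: a.
rewrite mulr_sumr; apply: eq_bigr => j _.
rewrite iint_sum => [|i]; last by apply: admZ; exact: a.
rewrite !mulr_sumr; apply: eq_bigr => i _; rewrite iintZ; last exact: a.
have jk : (j <= k)%N by rewrite -ltnS.
have ij : (i <= j)%N by rewrite -ltnS.
rewrite iint_Dk; last by lia.
(* For j > nu - k the term vanishes; otherwise i <= nu - k, so the truncated exponent nu - k - i is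
   a true difference and the powers of W(xi) cancel. *)
have [jn|nj] := leqP j (nu - k); last by rewrite (bin_small nj) !(mul0r, mulr0).
have w0 := wtC_neq0 xi.
have -> : (wt xi ^+ m)%:C = W xi ^+ (nu - k - i) * W xi ^+ (mu - k + i).
  by rewrite rmorphXn /= -exprD; congr (_ ^+ _); lia.
have := expf_neq0 (nu - k - i) w0; have := expf_neq0 (mu - k + i) w0.
move: (W xi ^+ (nu - k - i)) (W xi ^+ (mu - k + i)) (mu.+1%:R : C) m0 => a1 b1 x x0 b0 a0.
move: ('C(nu, k)%:R : C) c0 (Ber _ _ _) => y y0 be; field.
by rewrite a0 b0 x0 y0.
Qed.

Lemma pochN n : (k <= n)%N -> poch (- n%:R : R) k = (-1) ^+ k * (n ^_ k)%:R.
Proof.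
move=> kn; rewrite /poch ffact_prod natr_prod.
rewrite -[k in _ ^+ k](card_ord k) -prodr_const -big_split; apply: eq_bigr => i _ /=.
by rewrite natrB ?(leq_trans (ltnW (ltn_ord i)))//; ring.
Qed.

(** The signs of the two negative Pochhammer symbols cancel, leaving falling factorials; that of nu
    is k! C(nu,k), hence the division. The product is (mu+nu-2k+2)_k, written in nu - k, the
    variable of the limit. *)
Lemma Cmnk_sqr : cc ^+ 2 / 'C(nu, k)%:R =
  'C(mu, k)%:R * k`!%:R / \prod_(i < k) (nu - k + (mu - k + 2 + i))%:R.
Proof.
have pE : poch ((mu + nu - 2 * k)%:R + 2 : R) k = (\prod_(i < k) (nu - k + (mu - k + 2 + i)))%:R.
  rewrite natr_prod; apply: eq_bigr => i _; rewrite -natrD -natrD; congr (_%:R); lia.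
have sg : ((-1) ^+ k * (-1) ^+ k : R) = 1 by rewrite -exprMn mulrNN mulr1 expr1n.
have e : poch (- nu%:R : R) k * poch (- mu%:R) k = ((nu ^_ k) * (mu ^_ k))%:R.
  by rewrite !pochN// mulrACA sg mul1r natrM.
rewrite -rmorphXn /= /Cmnk sqr_sqrtr; last by rewrite e pE divr_ge0// ?mulr_ge0.
rewrite e pE -natrM realCM realCV !rmorph_nat -!bin_ffact -natr_prod !natrM.
have c0 : ('C(nu, k)%:R : C) != 0 by rewrite pnatr_eq0 -lt0n bin_gt0.
have f0 : (k`!%:R : C) != 0 by rewrite pnatr_eq0 -lt0n fact_gt0.
have p0 : ((\prod_(i < k) (nu - k + (mu - k + 2 + i)))%:R : C) != 0.
  by rewrite pnatr_eq0 -lt0n; apply: prodn_gt0 => i; lia.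
move: ((\prod_(i < k) _)%:R : C) p0 => x x0.
move: ('C(nu, k)%:R : C) c0 (k`!%:R : C) f0 => y y0 z z0; field.
by rewrite x0 y0 z0.
Qed.

End QuantumChannel.

(** * Assembly of the two limits *)

Theorem mainTheorem6 (R : realType) (mu k : nat) :
  (k <= mu)%N ->
  (forall f : R[i] -> R[i], ImR mu f ->
     unif_cvg (fun nu => BerInv mu (nu.+1%:R) nu f) f) /\
  (forall f : R[i] -> R[i], CP1cont f ->
     unif_cvg (fun nu => BerInv mu ((mu + nu - 2 * k).+1%:R) (mu + nu - 2 * k)
                           (Enu mu nu k f))
              (Emk mu k f)).
Proof.
move=> kmu; split=> f.
  move=> /ImR_inV Vf.
  (* A constant sequence, written as a sum with one term. *)
  have := @BerInv_cvg R mu id (fun=> f) 'I_1 (fun _ _ => 1) (fun=> 1) (fun=> f) 0.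
  have e : (fun z => \sum_(j < 1) 1 * f z) = f.
    by apply/funext => z; rewrite big_ord1 mul1r.
  rewrite e; apply => //.
  - by move=> M; exists M.
  - by move=> _; exact: ctends_cst.
move=> /adm_CP1 af.
pose H (j : 'I_k.+1) (z : R[i]) : R[i] :=
  \sum_(i < j.+1) (-1) ^+ i * 'C(j, i)%:R * Ber (mu - k + i) f z.
(* The division by j! offsets the j! placed in [beta], whose second factor then has the form of
   [ctends_bin_ratio]. *)
pose B (j : 'I_k.+1) : R[i] := 'C(mu, k)%:R * 'C(k, j)%:R * (k`!%:R / j`!%:R).
pose beta (j : 'I_k.+1) (nu : nat) : R[i] := B j *
  (('C(nu - k, j) * j`!)%:R / \prod_(i < k) (nu - k + (mu - k + 2 + i))%:R).
have := @BerInv_cvg R mu (fun nu => mu + nu - 2 * k)%N (fun nu => Enu mu nu k f)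
  'I_k.+1 beta (fun j => B j * (j == k :> nat)%:R) H k.
have f0 n : (n`!%:R : R[i]) != 0 by rewrite pnatr_eq0 -lt0n fact_gt0.
have -> : (fun z => \sum_j B j * (j == k :> nat)%:R * H j z) = Emk mu k f.
  apply/funext => z; rewrite /Emk (bigD1 ord_max)//= big1 => [|j]; last first.
    by rewrite -(inj_eq val_inj) /= => /negbTE ->; rewrite mulr0 mul0r.
  rewrite addr0 eqxx /B /H /= binn mulr1 mulfV// !mulr1; congr (_ * _).
  (* Substituting i = k - l turns B_{mu-k+i} into B_{mu-l}, and C(k,k-l) = C(k,l). *)
  rewrite big_mkord (reindex_inj rev_ord_inj) /=; apply: eq_bigr => i _.
  have ik : (i <= k)%N by rewrite -ltnS.
  rewrite subSS bin_sub//; congr (_ * _ * Ber _ f z); lia.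
apply.
- by move=> M; exists (M + 2 * k)%N => n; lia.
- move=> j; apply: inV_sum => i; apply: inVZ; apply: Ber_inV => //.
  by have := ltn_ord i; have := ltn_ord j; lia.
- move=> j; apply: ctendsZ.
  have jk : (j <= k)%N by rewrite -ltnS.
  apply: (@ctends_comp _ (fun n => ('C(n, j) * j`!)%:R /
     \prod_(i < k) (n + (mu - k + 2 + i))%:R) _ (fun n => n - k)%N).
    by move=> M; exists (M + k)%N => n; lia.
  exact (@ctends_bin_ratio R k (fun i => mu - k + 2 + i)%N j jk).
move=> nu knu; apply/funext => z; rewrite Enu_expand//; apply: eq_bigr => j _.
congr (_ * _); rewrite Cmnk_sqr// /beta /B natrM.
by have := f0 j; move: (j`!%:R : R[i]) (\prod_(i < k) _)^-1 => x y x0; field.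
Qed.
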